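(* Let $E/\mathbb{Q}$ be an elliptic curve over $\mathbb{Q}$. Then for every automorphism $\sigma\in\mathrm{Gal}(\overline{\mathbb{Q}}/\mathbb{Q})$, the Mordell–Weil group $E(\overline{\mathbb{Q}}^{\sigma})$ has infinite rank, where $\overline{\mathbb{Q}}^{\sigma}=\{x\in\overline{\mathbb{Q}}\mid \sigma(x)=x\}$.
   Context: $\overline{\mathbb{Q}}$ denotes a fixed algebraic closure of $\mathbb{Q}$. *)

(* Defs.v *)
From HB Require Import structures.
From mathcomp Require Import all_boot all_order all_algebra all_field.
From mathcomp Require Import ring.

Set Implicit Arguments.
Unset Strict Implicit.
Unset Printing Implicit Defensive.

Import GRing.Theory.
Local Open Scope ring_scope.

(* y^2 + a1 x y + a3 y = x^3 + a2 x^2 + a4 x + a6 *)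
Record weierstrass (R : Type) :=
  Weierstrass { wa1 : R; wa2 : R; wa3 : R; wa4 : R; wa6 : R }.

Definition map_weierstrass (R S : Type) (f : R -> S) (W : weierstrass R) :=
  Weierstrass (f (wa1 W)) (f (wa2 W)) (f (wa3 W)) (f (wa4 W)) (f (wa6 W)).

Definition discriminant (R : comNzRingType) (W : weierstrass R) : R :=
  let: Weierstrass a1 a2 a3 a4 a6 := W in
  let b2 := a1 ^+ 2 + 4 * a2 in
  let b4 := 2 * a4 + a1 * a3 in
  let b6 := a3 ^+ 2 + 4 * a6 in
  let b8 := a1 ^+ 2 * a6 + 4 * a2 * a6 - a1 * a3 * a4
            + a2 * a3 ^+ 2 - a4 ^+ 2 in
  - b2 ^+ 2 * b8 - 8 * b4 ^+ 3 - 27 * b6 ^+ 2 + 9 * b2 * b4 * b6.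

(* Every elliptic curve over a field has a Weierstrass equation, whose
   discriminant is nonzero exactly when the plane cubic is smooth. *)
Record elliptic_curve (F : fieldType) := EllipticCurve {
  ec_eqn :> weierstrass F;
  ec_smooth : discriminant ec_eqn != 0 }.

(* Points of the projective closure: the line at infinity meets the cubic in
   the single point [0 : 1 : 0], represented by Infty. *)
Inductive point (F : Type) := Infty | Affine of F & F.
Arguments Infty {F}.

Section GroupLaw.
Variables (F : fieldType) (W : weierstrass F).
Local Notation a1 := (wa1 W).
Local Notation a2 := (wa2 W).
Local Notation a3 := (wa3 W).
Local Notation a4 := (wa4 W).
Local Notation a6 := (wa6 W).

Definition on_curve (P : point F) : bool :=
  if P is Affine x y then
    y ^+ 2 + a1 * x * y + a3 * y == x ^+ 3 + a2 * x ^+ 2 + a4 * x + a6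
  else true.

Definition opp_pt (P : point F) : point F :=
  if P is Affine x y then Affine x (- y - a1 * x - a3) else Infty.

(* Chord-tangent law. On the curve, if x1 = x2 and the two points are not
   opposite, then they are equal, and l is the slope of the tangent line. *)
Definition add_pt (P Q : point F) : point F :=
  match P, Q with
  | Infty, _ => Q
  | _, Infty => P
  | Affine x1 y1, Affine x2 y2 =>
    if (x1 == x2) && (y1 == - y2 - a1 * x2 - a3) then Infty else
    let l := if x1 == x2
             then (3 * x1 ^+ 2 + 2 * a2 * x1 + a4 - a1 * y1)
                  / (2 * y1 + a1 * x1 + a3)
             else (y2 - y1) / (x2 - x1) in
    let x3 := l ^+ 2 + a1 * l - a2 - x1 - x2 in
    Affine x3 (- (l * (x3 - x1) + y1) - a1 * x3 - a3)
  end.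

Definition natmul_pt (P : point F) (n : nat) : point F :=
  iter n (add_pt P) Infty.

Definition intmul_pt (P : point F) (m : int) : point F :=
  match m with
  | Posz n => natmul_pt P n
  | Negz n => opp_pt (natmul_pt P n.+1)
  end.

(* For a subfield K of F containing the coefficients of W, this is the group
   W(K), viewed inside W(F). *)
Definition rational_point (K : {pred F}) (P : point F) : bool :=
  on_curve P && (if P is Affine x y then (x \in K) && (y \in K) else true).

Definition lin_indep_pt (n : nat) (P : 'I_n -> point F) : Prop :=
  forall m : 'I_n -> int,
    \big[add_pt/Infty]_(i < n) intmul_pt (P i) (m i) = Infty ->
    forall i, m i = 0.

(* The rank of an abelian group is the supremum of the lengths of its
   Z-linearly independent families. *)
Definition infinite_rank (K : {pred F}) : Prop :=
  forall n : nat, exists P : 'I_n -> point F,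
    (forall i, rational_point K (P i)) /\ lin_indep_pt P.

Lemma on_curve_opp P : on_curve P -> on_curve (opp_pt P).
Proof.
case: P => //= x y /eqP e; apply/eqP; rewrite -e; ring.
Qed.

Lemma add_ptN P : add_pt P (opp_pt P) = Infty.
Proof.
case: P => //= x y; rewrite eqxx /=.
by case: eqP => //= -[]; ring.
Qed.

Lemma on_curve_add P Q : on_curve P -> on_curve Q -> on_curve (add_pt P Q).
Proof.
case: P => [//|x1 y1]; case: Q => [//|x2 y2] /= /eqP e1 /eqP e2.
have [ex|nx] /= := eqVneq x1 x2; last first.
  have hx : x2 - x1 != 0 by rewrite subr_eq0 eq_sym.
  apply/eqP/eqP; rewrite -subr_eq0; apply/eqP.
  have E2 : a6 = y2 ^+ 2 + a1 * x2 * y2 + a3 * y2 - (x2 ^+ 3 + a2 * x2 ^+ 2 + a4 * x2) by rewrite e2; ring.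
  have E4 : a4 = ((y2 ^+ 2 + a1 * x2 * y2 + a3 * y2 - (x2 ^+ 3 + a2 * x2 ^+ 2))
     - (y1 ^+ 2 + a1 * x1 * y1 + a3 * y1 - (x1 ^+ 3 + a2 * x1 ^+ 2))) / (x2 - x1).
    apply: (canRL (mulfK hx)).
    have E1 : a6 = y1 ^+ 2 + a1 * x1 * y1 + a3 * y1 - (x1 ^+ 3 + a2 * x1 ^+ 2 + a4 * x1) by rewrite e1; ring.
    apply/eqP; rewrite -subr_eq0; apply/eqP; rewrite -(subrr a6) {1}E1 E2; ring.
  rewrite E2 E4; field; exact: hx.
rewrite -{}ex in e2 *.
have [//|ny] /= := eqVneq.
have ey : y1 = y2.
  apply/eqP; rewrite -subr_eq0; have : (y1 - y2) * (y1 - (- y2 - a1 * x1 - a3)) = 0.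
    by apply/eqP; rewrite -(subrr (x1 ^+ 3 + a2 * x1 ^+ 2 + a4 * x1 + a6)) -{1}e1 -e2; apply/eqP; ring.
  by move/eqP; rewrite mulf_eq0 => /orP[//|];
    rewrite (subr_eq0 y1 (- y2 - a1 * x1 - a3)) (negPf ny).
rewrite -{}ey in e2 ny *.
have hy : 2 * y1 + a1 * x1 + a3 != 0.
  apply: contraNneq ny => h; rewrite -subr_eq0 -h; apply/eqP; ring.
apply/eqP/eqP; rewrite -subr_eq0; apply/eqP.
have E1 : a6 = y1 ^+ 2 + a1 * x1 * y1 + a3 * y1 - (x1 ^+ 3 + a2 * x1 ^+ 2 + a4 * x1) by rewrite e1; ring.
rewrite E1; field; exact: hy.
Qed.

End GroupLaw.

(* Main.v *)
Require Import Defs.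
From HB Require Import structures.
From mathcomp Require Import all_boot all_order all_algebra all_field.
From mathcomp Require Import cyclic boolp ring zify.

(* Let K be the fixed field of sigma. Every finite extension of K is cyclic, so
   K^* / K^*2 has order at most 2, and K^* / K^*3 has order 1 or 3.  On
   y^2 = f(x) = x^3 + a x + b with integers a and b, this lets one produce
   points over K from rational parameters:
   - if a b <> 0, then x = - (b / a) (1 + t + t^2) / (t (1 + t)) satisfies
     f(t x) = t^3 f(x), so that f(x) or f(t x) is a square in K whenever the
     rational number t is not;
   - if b = 0, then (x1^2 + a) (x2^2 + a) is (x1 + x2)^2 (x3^2 + a) for
     x3 = (x1 x2 - a) / (x1 + x2), and six such values f(x) have a product in a
     given nonsquare class, so that one of them is a square in K;
   - if a = 0, a similar identity for y^2 - b yields a rational number y such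
     that y^2 - b is a cube in K.
   The parameters can be chosen so that the class of f(x), resp. y^2 - b, is
   ramified at an arbitrarily large prime q, and so that 1 / x is divisible by 4
   at all places above 2.  The second condition makes the point P nontorsion,
   because doubling multiplies 1 / x by 4 and a 2-adic unit.  The first one
   yields, for any given number field, an automorphism fixing that field and
   mapping P to - P, resp. (zeta x, y); so no nonzero multiple of P is defined
   over the field generated by the points already constructed. *)

Set Implicit Arguments.
Unset Strict Implicit.
Unset Printing Implicit Defensive.

Import GRing.Theory Num.Theory.
Local Open Scope ring_scope.

(** * The group law on a short Weierstrass curve *)

Definition short_eqn (R : nzRingType) (a b : R) := Weierstrass 0 0 0 a b.

Lemma add_pt_eqInfty (F : fieldType) (W : weierstrass F) P Q :
  add_pt W P Q = Infty -> P = opp_pt W Q.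
Proof.
case: P Q => [|x1 y1] [|x2 y2] //=.
by case: ifP => // /andP[/eqP -> /eqP ->].
Qed.

Lemma opp_ptK (F : fieldType) (W : weierstrass F) P : opp_pt W (opp_pt W P) = P.
Proof. by case: P => //= x y; congr Affine; ring. Qed.

Section ShortCurve.
Variables (F : fieldType) (a b : F).
Hypothesis two_neq0 : (2 : F) != 0.
Hypothesis disc_neq0 : 4 * a ^+ 3 + 27 * b ^+ 2 != 0.
Local Notation W := (short_eqn a b).
Local Notation "P +' Q" := (add_pt W P Q) (at level 50, left associativity).
Local Notation "-' P" := (opp_pt W P) (at level 35, P at level 35).

Lemma on_shortE x y :
  on_curve W (Affine x y) = (y ^+ 2 == x ^+ 3 + a * x + b).
Proof. by rewrite /= !mul0r !addr0. Qed.

Lemma opp_shortE x y : -' (Affine x y) = Affine x (- y).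
Proof. by rewrite /= mul0r !subr0. Qed.

(* The second equation makes sense for tangents as well as for chords. *)
Definition is_slope l x1 y1 x2 y2 :=
  l * (x1 - x2) = y1 - y2 /\
  l * (y1 + y2) = x1 ^+ 2 + x1 * x2 + x2 ^+ 2 + a.

Lemma add_short_opp x y : Affine x y +' Affine x (- y) = Infty.
Proof. by rewrite /= !mul0r !subr0 opprK !eqxx. Qed.

Lemma add_short_oppl x y : Affine x (- y) +' Affine x y = Infty.
Proof. by rewrite -{2}[y]opprK add_short_opp. Qed.

Lemma slope_ex x1 y1 x2 y2 :
  on_curve W (Affine x1 y1) -> on_curve W (Affine x2 y2) ->
  ~~ ((x1 == x2) && (y1 == - y2)) ->
  exists2 l, is_slope l x1 y1 x2 y2 &
   Affine x1 y1 +' Affine x2 y2 =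
   Affine (l ^+ 2 - x1 - x2) (l * (x1 - (l ^+ 2 - x1 - x2)) - y1).
Proof.
rewrite !on_shortE => /eqP e1 /eqP e2 nopp.
have -> : Affine x1 y1 +' Affine x2 y2 =
  let l := if x1 == x2 then (3 * x1 ^+ 2 + a) / (2 * y1)
           else (y2 - y1) / (x2 - x1) in
  Affine (l ^+ 2 - x1 - x2) (l * (x1 - (l ^+ 2 - x1 - x2)) - y1).
  rewrite /= !(mul0r, mulr0, addr0, subr0) (negPf nopp).
  by case: ifP => _; congr Affine; ring.
have [ex|nx] := eqVneq x1 x2; last first.
  have hx : x2 - x1 != 0 by rewrite subr_eq0 eq_sym.
  exists ((y2 - y1) / (x2 - x1)) => //; rewrite /is_slope.
  have -> : a = ((y2 ^+ 2 - x2 ^+ 3) - (y1 ^+ 2 - x1 ^+ 3)) / (x2 - x1).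
    by apply: (canRL (mulfK hx)); rewrite e1 e2; ring.
  by split; field.
rewrite ex eqxx /= in nopp *; subst x2.
have ey : y1 = y2.
  apply/eqP; rewrite -subr_eq0; have : (y1 - y2) * (y1 - - y2) = 0.
    by rewrite opprK -subr_sqr e1 e2 subrr.
  by move/eqP; rewrite mulf_eq0 => /orP[//|]; rewrite (subr_eq0 y1 (- y2)) (negPf nopp).
subst y2; have hy : y1 != 0.
  by apply: contraNneq nopp => ->; rewrite oppr0.
exists ((3 * x1 ^+ 2 + a) / (2 * y1)) => //.
by split; field; rewrite ?two_neq0 ?hy.
Qed.

Lemma slope_uniq l m x1 y1 x2 y2 :
  is_slope l x1 y1 x2 y2 -> is_slope m x1 y1 x2 y2 ->
  ~~ ((x1 == x2) && (y1 == - y2)) -> l = m.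
Proof.
move=> [l1 l2] [m1 m2]; apply: contraNeq; rewrite -subr_eq0 => nlm.
have h1 : (l - m) * (x1 - x2) = 0 by rewrite mulrBl l1 m1 subrr.
have h2 : (l - m) * (y1 + y2) = 0 by rewrite mulrBl l2 m2 subrr.
move: h1 h2 => /eqP + /eqP; rewrite !mulf_eq0 (negPf nlm) /=.
by rewrite subr_eq0 addr_eq0 => -> ->.
Qed.

Lemma add_slope l x1 y1 x2 y2 :
  on_curve W (Affine x1 y1) -> on_curve W (Affine x2 y2) ->
  ~~ ((x1 == x2) && (y1 == - y2)) -> is_slope l x1 y1 x2 y2 ->
  Affine x1 y1 +' Affine x2 y2 =
  Affine (l ^+ 2 - x1 - x2) (l * (x1 - (l ^+ 2 - x1 - x2)) - y1).
Proof.
move=> c1 c2 no sl; have [m sm ->] := slope_ex c1 c2 no.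
by rewrite (slope_uniq sm sl no).
Qed.

Lemma add_pt0 P : P +' Infty = P. Proof. by case: P. Qed.

Lemma add_ptC P Q : on_curve W P -> on_curve W Q -> P +' Q = Q +' P.
Proof.
case: P Q => [|x1 y1] [|x2 y2] // c1 c2.
have [/andP[/eqP -> /eqP ->]|no] := boolP ((x1 == x2) && (y1 == - y2)).
  by rewrite add_short_oppl add_short_opp.
have [l [s1 s2] ->] := slope_ex c1 c2 no.
have s' : is_slope l x2 y2 x1 y1.
  split; first by rewrite -opprB mulrN s1 opprB.
  by rewrite addrC s2; ring.
have no' : ~~ ((x2 == x1) && (y2 == - y1)).
  apply: contra no => /andP[/eqP -> /eqP ->]; by rewrite opprK !eqxx.
rewrite (add_slope c2 c1 no' s'); congr Affine; first by ring.
have -> : y1 = y2 + l * (x1 - x2) by rewrite s1; ring.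
ring.
Qed.

Lemma opp_add P Q : on_curve W P -> on_curve W Q ->
  -' (P +' Q) = (-' P) +' (-' Q).
Proof.
case: P Q => [|x1 y1] [|x2 y2] // c1 c2.
have c1' := on_curve_opp c1; have c2' := on_curve_opp c2.
have [/andP[/eqP -> /eqP ->]|no] := boolP ((x1 == x2) && (y1 == - y2)).
  by rewrite !opp_shortE opprK add_short_oppl add_short_opp.
rewrite !opp_shortE in c1' c2' *.
have [l [s1 s2] ->] := slope_ex c1 c2 no.
have s' : is_slope (- l) x1 (- y1) x2 (- y2).
  by split; [rewrite mulNr s1; ring | rewrite -s2; ring].
have no' : ~~ ((x1 == x2) && (- y1 == - - y2)) by rewrite eqr_opp.
by rewrite (add_slope c1' c2' no' s') opp_shortE; congr Affine; ring.
Qed.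

(** The line through P and Q, reflected in the x-axis, passes through P + Q and - Q, which gives the
    slope - l. The degenerate cases of [add_ptA] reduce to this cancellation. *)
Lemma add_ptK P Q : on_curve W P -> on_curve W Q -> (P +' Q) +' (-' Q) = P.
Proof.
case: P Q => [|x1 y1] [|x2 y2] // c1 c2; first exact: add_ptN.
have [/andP[/eqP -> /eqP ->]|no] := boolP ((x1 == x2) && (y1 == - y2)).
  by rewrite add_short_oppl opp_shortE.
have c3 := on_curve_add c1 c2; have c2' := on_curve_opp c2.
have [l [s1 s2] e] := slope_ex c1 c2 no.
rewrite e opp_shortE in c3 c2' *.
have ey : y1 = y2 + l * (x1 - x2) by rewrite s1; ring.
have ea : a = l * (y1 + y2) - (x1 ^+ 2 + x1 * x2 + x2 ^+ 2) by rewrite s2; ring.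
set x3 := l ^+ 2 - x1 - x2 in c3 *; set y3 := l * (x1 - x3) - y1 in c3 *.
have s' : is_slope (- l) x3 y3 x2 (- y2).
  by rewrite /is_slope ea /y3 ey /x3; split; ring.
(* If P + Q = Q, then y2 = 0 and a nonvertical line is tangent at Q, where a smooth cubic has a
   vertical tangent; so the discriminant would vanish. *)
have no' : ~~ ((x3 == x2) && (y3 == - - y2)).
  apply: contra disc_neq0 => /andP[/eqP ex /eqP ey3].
  have ex1 : x1 = l ^+ 2 - 2 * x2.
    by have -> : x1 = l ^+ 2 - x2 - x3 by [rewrite /x3; ring]; rewrite ex; ring.
  have ey2 : y2 = 0.
    apply/eqP; have : 2 * y2 = 0.
      have e3 : y3 = - y2 by rewrite /y3 ex ey; ring.
      by rewrite mulr_natl mulr2n -{1}[y2]opprK -ey3 e3 addNr.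
    by move/eqP; rewrite mulf_eq0 (negPf two_neq0).
  have eb : b = y2 ^+ 2 - x2 ^+ 3 - a * x2.
    by move: c2; rewrite on_shortE => /eqP ->; ring.
  by rewrite eb ea ey ey2 ex1; apply/eqP; ring.
by rewrite (add_slope c3 c2' no' s'); congr Affine; rewrite /y3 /x3; ring.
Qed.

(** When a partial or total sum is [Infty], cancellation suffices. Otherwise [is_slope] treats
    chords and tangents alike, and both sides are computed from the slopes l and m of the lines
    through the first two and the last two points. *)
Lemma add_ptA P Q R : on_curve W P -> on_curve W Q -> on_curve W R ->
  P +' (Q +' R) = (P +' Q) +' R.
Proof.
move=> cP cQ cR.
have cPQ := on_curve_add cP cQ; have cQR := on_curve_add cQ cR.
have cnP := on_curve_opp cP; have cnQ := on_curve_opp cQ.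
have cnR := on_curve_opp cR.
have addK X Y : on_curve W X -> on_curve W Y -> (-' X) +' (X +' Y) = Y.
  move=> cX cY; rewrite (add_ptC (on_curve_opp cX) (on_curve_add cX cY)).
  by rewrite (add_ptC cX cY) add_ptK.
have [/add_pt_eqInfty ->|nPQ] := pselect (P +' Q = Infty).
  by rewrite addK // (add_ptC cnQ cQ) add_ptN.
have [eQR|nQR] := pselect (Q +' R = Infty).
  have eR : R = -' Q by apply: add_pt_eqInfty; rewrite add_ptC.
  by rewrite eR add_ptK // add_ptN add_pt0.
have [e1|n1] := pselect (P +' Q +' R = Infty).
  rewrite e1; have eR : R = -' P +' -' Q.
    by rewrite -opp_add //; apply: add_pt_eqInfty; rewrite add_ptC.
  have cNN := on_curve_add cnP cnQ.
  rewrite eR (add_ptC cQ cNN) -{2}[Q](opp_ptK W) add_ptK // add_ptN //.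
have [e2|n2] := pselect (P +' (Q +' R) = Infty).
  rewrite e2; have eP : P = -' Q +' -' R.
    by rewrite -opp_add //; apply: add_pt_eqInfty.
  have cNN := on_curve_add cnQ cnR.
  have -> : P +' Q = -' R.
    by rewrite eP (add_ptC cNN cQ) -{1}[Q](opp_ptK W) addK.
  by rewrite (add_ptC cnR cR) add_ptN.
case: P Q R cP cQ cR cPQ cQR nPQ nQR n1 n2 {cnP cnQ cnR}
  => [|xa ya] [|xb yb] [|xc yc] cA cB cC cS cT nAB nBC nSC nAT;
  rewrite ?add_pt0 //.
have nopp x1 y1 x2 y2 : Affine x1 y1 +' Affine x2 y2 <> Infty ->
  ~~ ((x1 == x2) && (y1 == - y2)).
  by move=> h; apply/negP => /andP[/eqP e1 /eqP e2]; apply: h; rewrite e1 e2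
    add_short_oppl.
have [l [l1 l2] eS] := slope_ex cA cB (nopp _ _ _ _ nAB).
have [m [m1 m2] eT] := slope_ex cB cC (nopp _ _ _ _ nBC).
have eya : ya = yb + l * (xa - xb) by rewrite l1; ring.
have eyc : yc = yb + m * (xc - xb) by rewrite -opprB mulrN m1; ring.
have ea : a = l * (ya + yb) - (xa ^+ 2 + xa * xb + xb ^+ 2) by rewrite l2; ring.
have er : (xa - xc) * (xa + xb + xc) =
  2 * yb * (l - m) + l ^+ 2 * (xa - xb) - m ^+ 2 * (xc - xb).
  transitivity (l * (ya + yb) - m * (yb + yc)); first by rewrite l2 m2; ring.
  by rewrite eya eyc; ring.
(* Equal slopes mean that the outer points coincide, where commutativity suffices, or that the three
   points are collinear, where the sum would be [Infty]. *)
have [elm|nlm] := eqVneq l m.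
  subst m; have : (xa - xc) * (xa + xb + xc - l ^+ 2) = 0.
    by rewrite mulrBr er; ring.
  move/eqP; rewrite mulf_eq0 !subr_eq0 => /orP[/eqP exx|/eqP exx].
    have eyy : ya = yc by rewrite eya eyc exx.
    by rewrite -exx -eyy in cC cT *; rewrite (add_ptC cB cA) (add_ptC cS cA).
  case: nSC; rewrite eS.
  have -> : l ^+ 2 - xa - xb = xc by rewrite -exx; ring.
  have -> : l * (xa - xc) - ya = - yc by rewrite eya eyc; ring.
  by rewrite add_short_oppl.
have hlm : l - m != 0 by rewrite subr_eq0.
(* The function q(x) - k y, with q monic of degree 2, vanishes at the three
   points; so k is symmetric in them. *)
pose k := (xa - xc) / (l - m).
have exa : xa = xc + k * (l - m) by rewrite /k divfK //; ring.
(* The equation [er] is linear in yb. From here on xb, xc, k, l and m are free parameters, and the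
   remaining claims are identities of rational functions in them. *)
have eyb : yb = (k * (xa + xb + xc) - (l + m) * (xc - xb) - l ^+ 2 * k) / 2.
  apply: (mulIf hlm); apply: (mulIf two_neq0); rewrite [RHS]mulrAC divfK //.
  have -> : yb * (l - m) * 2 = 2 * yb * (l - m) by ring.
  have -> : 2 * yb * (l - m) = (xa - xc) * (xa + xb + xc)
    - l ^+ 2 * (xa - xb) + m ^+ 2 * (xc - xb) by rewrite er; ring.
  by rewrite exa; ring.
rewrite eS eT in cS cT nSC nAT *.
have sS : is_slope (k - l) (l ^+ 2 - xa - xb)
   (l * (xa - (l ^+ 2 - xa - xb)) - ya) xc yc.
  by split; rewrite ?ea ?eya ?eyc ?eyb exa; field; rewrite two_neq0.
have sT : is_slope (k - m) xa ya (m ^+ 2 - xb - xc)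
   (m * (xb - (m ^+ 2 - xb - xc)) - yb).
  by split; rewrite ?ea ?eya ?eyb exa; field; rewrite two_neq0.
rewrite (add_slope cS cC (nopp _ _ _ _ nSC) sS).
rewrite (add_slope cA cT (nopp _ _ _ _ nAT) sT).
by congr Affine; rewrite ?eya ?eyc ?eyb exa; field; rewrite ?two_neq0.
Qed.

Local Notation "n *' P" := (natmul_pt W P n) (at level 40).

Lemma natmulS P n : n.+1 *' P = P +' n *' P. Proof. by []. Qed.

Lemma on_natmul P n : on_curve W P -> on_curve W (n *' P).
Proof. by move=> cP; elim: n => // n IH; apply: on_curve_add. Qed.

Lemma natmulD P m n : on_curve W P -> (m + n) *' P = m *' P +' n *' P.
Proof.
move=> cP; elim: m => // m IH.
by rewrite addSn !natmulS IH add_ptA // on_natmul.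
Qed.

Lemma natmulM P m n : on_curve W P -> (m * n) *' P = m *' (n *' P).
Proof. by move=> cP; elim: m => // m IH; rewrite mulSn natmulD // IH. Qed.

Lemma natmul_addP P Q n : on_curve W P -> on_curve W Q ->
  n *' (P +' Q) = n *' P +' n *' Q.
Proof.
move=> cP cQ; elim: n => // n IH; rewrite !natmulS {}IH.
have cnP := on_natmul n cP; have cnQ := on_natmul n cQ.
have cPn := on_curve_add cP cnP; have cQn := on_curve_add cQ cnQ.
have cPQ := on_curve_add cP cQ.
rewrite add_ptA // -(add_ptA cP cQ cnP) (add_ptC cQ cnP) (add_ptA cP cnP cQ).
by rewrite -add_ptA.
Qed.

Lemma natmul_opp P n : on_curve W P -> n *' (-' P) = -' (n *' P).
Proof.
by move=> cP; elim: n => // n IH; rewrite !natmulS {}IH opp_add // on_natmul.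
Qed.

Lemma natmul_Infty n : n *' Infty = Infty.
Proof. by elim: n. Qed.

End ShortCurve.

(** * Points close to infinity at the places above 2 *)

(* The algebraic numbers that are integral at every place above 2. *)
Definition A2 : {pred algC} :=
  fun x => `[< exists2 m : nat, odd m & m%:R * x \in Aint >].

Lemma A2P x : reflect (exists2 m : nat, odd m & m%:R * x \in Aint) (x \in A2).
Proof. exact: asboolP. Qed.

Lemma Aint_nat n : n%:R \in Aint.
Proof. exact: Aint_int n. Qed.

Lemma A2_Aint x : x \in Aint -> x \in A2.
Proof. by move=> Ax; apply/A2P; exists 1%N => //; rewrite mul1r. Qed.

Fact A2_subring : subring_closed A2.
Proof.
split=> [|x y /A2P[m om Ax] /A2P[n on Ay]|x y /A2P[m om Ax] /A2P[n on Ay]].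
- exact/A2_Aint/Aint1.
- apply/A2P; exists (m * n)%N; first by rewrite oddM om on.
  have -> : (m * n)%:R * (x - y) = n%:R * (m%:R * x) - m%:R * (n%:R * y).
    by rewrite natrM; ring.
  by apply: rpredB; apply: rpredM => //; apply: Aint_nat.
- apply/A2P; exists (m * n)%N; first by rewrite oddM om on.
  by rewrite natrM mulrACA rpredM.
Qed.
HB.instance Definition _ := GRing.isSubringClosed.Build algC A2 A2_subring.

Lemma A2_odd_inv m : odd m -> m%:R^-1 \in A2.
Proof.
move=> om; apply/A2P; exists m => //; rewrite mulfV ?Aint1 //.
by rewrite pnatr_eq0; case: m om.
Qed.

Lemma A2_odd_int_inv (m : int) : odd `|m|%N -> m%:~R^-1 \in A2.
Proof.
move=> om; case: (intP m) om => [//|n|n] /= on.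
  by rewrite -pmulrn A2_odd_inv.
by rewrite rmorphN invrN rpredN /= -pmulrn A2_odd_inv.
Qed.

Lemma A2_half : 2^-1 \notin A2.
Proof.
apply/negP => /A2P[m om Am].
have : (m%:R / 2 : algC) \in Num.int.
  by apply: Cint_rat_Aint => //; rewrite rpred_div ?rpred_nat.
case/intrP => k ek; have : (m%:R : algC) = (2 * k)%:~R.
  by rewrite rmorphM /= -ek mulrC divfK // pnatr_eq0.
by rewrite -[m%:R]/(m%:~R) => /intr_inj; lia.
Qed.

(** For curves with a = 0 only the cube of 1 / x is rational, so integrality above 2 has to pass to
    cube roots. Here (m x)^3 = m^2 (m x^3) is integral, and m x is a root of its minimal polynomial
    composed with X^3. *)
Lemma A2_cube x : x ^+ 3 \in A2 -> x \in A2.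
Proof.
case/A2P => m om Am; apply/A2P; exists m => //.
have A3 : (m%:R * x) ^+ 3 \in Aint.
  have -> : (m%:R * x) ^+ 3 = m%:R ^+ 2 * (m%:R * x ^+ 3) by ring.
  by rewrite rpredM ?rpredX ?Aint_nat.
have := root_minCpoly ((m%:R * x) ^+ 3); set c := minCpoly _ => rc.
apply: (@root_monic_Aint (c \Po 'X^3)).
- by rewrite root_comp /= hornerXn.
- have mc : c \is monic := minCpoly_monic _.
  rewrite monicE lead_coef_comp ?size_polyXn // (monicP mc) mul1r.
  by rewrite (monicP (monicXn _ _)) expr1n.
- by rewrite polyOver_comp // ?polyOverXn //.
Qed.

(** Among algebraic integers, u = m + 2 x divides an odd integer: in a monic integral equation for
    x, put x = (u - m) / 2 and clear denominators; the constant term in u is then congruent to (-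
    m)^n modulo 2. *)
Lemma A2_unit w : w \in A2 -> 1 + 2 * w != 0 /\ (1 + 2 * w)^-1 \in A2.
Proof.
case/A2P => m om Ax.
have m0 : (m%:R : algC) != 0 by rewrite pnatr_eq0; case: m om {Ax}.
have ew : w = (m%:R * w) / m%:R by field.
move: (m%:R * w) Ax ew => x Ax ->.
pose u := m%:R + 2 * x.
have -> : 1 + 2 * (x / m%:R) = u / m%:R by rewrite /u; field.
suff [N oN [B AB euB]] : exists2 N : int, odd `|N| &
    exists2 B, B \in Aint & u * B = N%:~R.
  have N0 : (N%:~R : algC) != 0 by rewrite intr_eq0; case: (N) oN => [[|n]|n].
  have u0 : u != 0 by apply: contraNneq N0 => u0; rewrite -euB u0 mul0r.
  have B0 : B != 0 by apply: contraNneq N0 => B0; rewrite -euB B0 mulr0.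
  split; first by rewrite mulf_neq0 ?invr_eq0.
  have -> : (u / m%:R)^-1 = m%:R * (B * N%:~R^-1).
    by rewrite -euB; field; rewrite ?u0 ?m0 ?B0.
  by rewrite !rpredM ?rpred_nat ?A2_odd_int_inv ?A2_Aint.
have := root_minCpoly x; set c := minCpoly x => rc.
have mc : c \is monic := minCpoly_monic _.
have Ic i : c`_i \in Num.int by move: Ax => /polyOverP.
have szc : size c = (size c).-1.+1.
  by rewrite prednK // lt0n size_poly_eq0 monic_neq0.
move: szc; set n := (size c).-1 => szc.
have cn : c`_n = 1 := monicP mc.
have Au : u \in Aint.
  by rewrite rpredD ?Aint_nat // rpredM // Aint_nat.
(* The expression 2^n c((u - m) / 2), which vanishes, is split as N + u B, where N is its value at u
   = 0. *)
pose B := \sum_(i < n.+1) c`_i * 2 ^+ (n - i) *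
   \sum_(j < i) (u - m%:R) ^+ (i.-1 - j) * (- m%:R) ^+ j.
pose N := \sum_(i < n.+1) c`_i * 2 ^+ (n - i) * (- m%:R : algC) ^+ i.
have eNB : N + u * B = 0.
  transitivity (2 ^+ n * c.[x]); last by rewrite (rootP rc) mulr0.
  rewrite horner_coef szc !mulr_sumr -big_split /=; apply: eq_bigr => i _.
  have -> : 2 ^+ n * (c`_i * x ^+ i) = c`_i * 2 ^+ (n - i) * (u - m%:R) ^+ i.
    have -> : u - m%:R = 2 * x by rewrite /u; ring.
    have -> : 2 ^+ n = 2 ^+ (n - i) * 2 ^+ i :> algC.
      by rewrite -exprD subnK // -ltnS.
    rewrite exprMn; move: (2 ^+ _) (2 ^+ i) (x ^+ i) c`_i => t1 t2 t3 t4; ring.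
  have := subrXX (u - m%:R) (- m%:R) i; rewrite opprK subrK => /eqP.
  rewrite subr_eq => /eqP ->; set S := \sum_(j < i) _.
  by rewrite mulrDr mulrCA addrC.
have AB : B \in Aint.
  apply: rpred_sum => k _; apply: rpredM.
    by apply: rpredM; [apply: Aint_Cint | apply/rpredX/Aint_nat].
  apply: rpred_sum => j _; apply: rpredM; apply: rpredX.
    by apply: rpredB => //; apply: Aint_nat.
  by rewrite rpredN Aint_nat.
pose M := \sum_(i < n) c`_i * 2 ^+ (n.-1 - i) * (- m%:R : algC) ^+ i.
have IM : M \in Num.int.
  by apply: rpred_sum => k _; rewrite !rpredM ?rpredX ?rpredN ?rpred_nat.
have eN : N = (- m%:R) ^+ n + 2 * M.
  rewrite /N big_ord_recr /= subnn cn expr0 !mul1r addrC; congr (_ + _).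
  rewrite mulr_sumr; apply: eq_bigr => i _.
  have -> : (n - i = (n.-1 - i).+1)%N by have := ltn_ord i; lia.
  rewrite exprS; move: (2 ^+ _) (_ ^+ i) c`_i => t1 t2 t3; ring.
case/intrP: IM => k ek.
exists (- ((- m%:Z) ^+ n + 2 * k)).
  have : odd `|((- m%:Z) ^+ n)|%N by rewrite abszX abszN oddX om orbT.
  lia.
exists B => //; have -> : u * B = - N.
  by apply/eqP; rewrite -addr_eq0 addrC eNB.
by rewrite eN ek rmorphN rmorphD rmorphXn rmorphN rmorphM.
Qed.

Definition unit2 (u : algC) := (u \in A2) && (u^-1 \in A2) && (u != 0).

Lemma unit2_mul u v : unit2 u -> unit2 v -> unit2 (u * v).
Proof.
move=> /andP[/andP[u1 u2] u3] /andP[/andP[v1 v2] v3].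
by rewrite /unit2 invfM !rpredM // mulf_neq0.
Qed.

Lemma unit2_inv u : unit2 u -> unit2 u^-1.
Proof. by move=> /andP[/andP[u1 u2] u3]; rewrite /unit2 invrK u1 u2 invr_eq0. Qed.

Lemma unit2_1D w : w \in A2 -> unit2 (1 + 2 * w).
Proof.
move=> Aw; have [h1 h2] := A2_unit Aw.
by rewrite /unit2 h1 h2 rpredD ?rpredM ?rpred1 ?rpred_nat.
Qed.

Definition small2 (x : algC) := (x != 0) && (x^-1 / 4 \in A2).

Section NonTorsion.
Variables a b : int.
Hypothesis disc_neq0 : 4 * a ^+ 3 + 27 * b ^+ 2 != 0.
Local Notation A := (a%:~R : algC).
Local Notation B := (b%:~R : algC).
Local Notation W := (short_eqn A B).

Lemma two_neq0C : (2 : algC) != 0. Proof. by rewrite pnatr_eq0. Qed.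

Lemma disc_neq0C : 4 * (a%:~R : algC) ^+ 3 + 27 * b%:~R ^+ 2 != 0.
Proof.
have -> : 4 * (a%:~R : algC) ^+ 3 + 27 * b%:~R ^+ 2
  = (4 * a ^+ 3 + 27 * b ^+ 2)%:~R by ring.
by rewrite intr_eq0.
Qed.

Lemma double_small x y : on_curve W (Affine x y) -> small2 x ->
  exists x' y' u, [/\ add_pt W (Affine x y) (Affine x y) = Affine x' y',
    small2 x', unit2 u & x'^-1 = 4 * u * x^-1].
Proof.
move=> c /andP[x0 Aw]; have := c; rewrite on_shortE => /eqP ey.
have n4 : (4 : algC) != 0 by rewrite pnatr_eq0.
have : x^-1 / 4 != 0 by rewrite mulf_neq0 ?invr_eq0.
have : x = (4 * (x^-1 / 4))^-1 by rewrite mulrC divfK ?invrK.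
move: (x^-1 / 4) Aw => w Aw ex w0.
(* For x = 1 / (4 w) these are 64 w^3 (x^3 + A x + B) and 256 w^4 (x^4 - 2 A x^2 - 8 B x + A^2): up
   to scaling, the denominator and the numerator of the duplication formula. *)
pose D1 := 1 + 2 * (8 * A * w ^+ 2 + 32 * B * w ^+ 3).
pose D2 := 1 + 2 * (128 * A ^+ 2 * w ^+ 4 - 16 * A * w ^+ 2 - 256 * B * w ^+ 3).
have U1 : unit2 D1.
  by apply: unit2_1D; rewrite rpredD // !rpredM ?rpredX ?rpred_int ?rpred_nat.
have U2 : unit2 D2.
  by apply: unit2_1D; rewrite !rpredB // !rpredM ?rpredX ?rpred_int ?rpred_nat.
have D1n : D1 != 0 by case/andP: U1.
have D2n : D2 != 0 by case/andP: U2.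
have ey2 : y ^+ 2 = D1 / (64 * w ^+ 3).
  by rewrite ey ex /D1; field; rewrite w0.
have yn : y != 0.
  apply: contraNneq D1n => y0; move: ey2; rewrite y0 expr0n /=.
  have d0 : 64 * w ^+ 3 != 0 by rewrite mulf_neq0 ?expf_neq0 ?pnatr_eq0.
  by move/esym/eqP; rewrite mulf_eq0 invr_eq0 (negPf d0) orbF.
pose l := (3 * x ^+ 2 + A) / (2 * y).
have sl : is_slope A l x y x y by split; rewrite /l; field; rewrite yn.
have no : ~~ ((x == x) && (y == - y)).
  rewrite eqxx /= -addr_eq0 -mulr2n -mulr_natl mulf_eq0 (negPf yn).
  by rewrite pnatr_eq0.
have el : l ^+ 2 = (3 * x ^+ 2 + A) ^+ 2 / (4 * y ^+ 2) by rewrite /l; field.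
pose u := D1 / D2; have Uu : unit2 u by rewrite unit2_mul ?unit2_inv.
have un : u != 0 by case/andP: Uu.
have ex' : (l ^+ 2 - x - x) = (4 * u * x^-1)^-1.
  rewrite el ey2 ex /u invrK; rewrite /D1 /D2 in D1n D2n *; field.
  by rewrite ?w0 ?D1n ?D2n.
exists (l ^+ 2 - x - x), (l * (x - (l ^+ 2 - x - x)) - y), u.
split=> //; first exact: (add_slope two_neq0C c c no sl).
  rewrite ex' /small2 invr_eq0 invrK !mulf_neq0 ?invr_eq0 //=.
  have -> : 4 * u / x / 4 = 4 * u * w by rewrite ex; field; rewrite w0.
  case/andP: Uu => /andP[Au _] _; do 2 apply: rpredM => //.
  exact: rpred_nat.
by rewrite ex' invrK.
Qed.

Lemma double_iter_small x y k : on_curve W (Affine x y) -> small2 x ->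
  exists x' y' u, [/\ natmul_pt W (Affine x y) (2 ^ k) = Affine x' y',
    small2 x', unit2 u & x'^-1 = 4 ^+ k * u * x^-1].
Proof.
move=> c sx; elim: k => [|k [x1 [y1 [u [e1 s1 U1 ex1]]]]].
  exists x, y, 1; split=> //; last by rewrite !mul1r.
  by rewrite /unit2 invr1 rpred1 oner_neq0.
have c1 : on_curve W (Affine x1 y1) by rewrite -e1 on_natmul.
have [x2 [y2 [v [e2 s2 U2 ex2]]]] := double_small c1 s1.
exists x2, y2, (v * u); split=> //; last by rewrite ex2 ex1 exprS; ring.
  by rewrite expnS natmulM ?two_neq0C ?disc_neq0C // e1 -e2.
exact: unit2_mul.
Qed.

(** Write n = 2^s t with t odd, and f for the totient of t. If n P = 0, then 2^(s + f) P = 2^s P;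
    but the two values of 1 / x differ by 4^f times a unit above 2, which would put 1 / 2 in
    [A2]. *)
Lemma small2_nontorsion x y n : on_curve W (Affine x y) -> small2 x ->
  (0 < n)%N -> natmul_pt W (Affine x y) n <> Infty.
Proof.
move=> c sx n0 en.
have [t ct et] := pfactor_coprime (isT : prime 2) n0; set s := logn 2 n in et.
have t0 : (0 < t)%N by rewrite lt0n; apply: contraTneq n0; rewrite et => ->.
have : (2 ^ totient t = 1 %[mod t])%N by apply: Euler_exp_totient.
have f0 : (0 < totient t)%N by rewrite totient_gt0.
set f := totient t in f0 * => e2.
have [j ej] : exists j, (2 ^ f = 1 + t * j)%N.
  have h : (t %| 2 ^ f - 1)%N by rewrite -eqn_mod_dvd ?expn_gt0 //; apply/eqP.
  case/dvdnP: h => j ej; exists j; rewrite mulnC -ej subnKC // expn_gt0 //.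
have eP : natmul_pt W (Affine x y) (2 ^ (s + f)) = natmul_pt W (Affine x y) (2 ^ s).
  rewrite expnD ej mulnDr muln1 mulnA [(_ * t)%N]mulnC -et mulnC.
  rewrite natmulD ?natmulM ?two_neq0C ?disc_neq0C // en natmul_Infty.
  by rewrite add_pt0.
have [x1 [y1 [u [e1 s1 U1 ex1]]]] := double_iter_small s c sx.
have [x2 [y2 [v [e2' s2 U2 ex2]]]] := double_iter_small (s + f) c sx.
move: eP; rewrite e1 e2' => -[exx _].
have xn : x != 0 by case/andP: sx.
have n4 k : (4 : algC) ^+ k != 0 by rewrite expf_neq0 // pnatr_eq0.
move: ex2; rewrite exx ex1 exprD => /(mulIf (invr_neq0 xn)).
rewrite -[_ * _ * v]mulrA => /(mulfI (n4 _)) euv.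
have : 2^-1 \notin A2 := A2_half.
have /andP[/andP[Au Au'] un] := U1.
have /andP[/andP[Av _] _] := U2.
have -> : 2^-1 = 2 * 4 ^+ f.-1 * (v * u^-1) :> algC.
  rewrite {1}euv -{2}(prednK f0) exprS; move: (n4 f.-1) => n4'.
  have vn : v != 0 by case/andP: U2.
  by field; rewrite vn n4'.
by rewrite !rpredM ?rpredX ?rpred_nat.
Qed.

End NonTorsion.

(** * Automorphisms and infinite rank *)

(** The splitting field of the minimal polynomial of x is Galois over the rationals, and its
    automorphisms extend to [algC]. *)
Lemma aut_fixed_rat (x : algC) :
  (forall nu : {rmorphism algC -> algC}, nu x = x) -> x \in Crat.
Proof.
move=> fixx.
have [q [Dq mon_q] dv_q] := minCpolyP x.
have [r Dr] := closed_field_poly_normal (minCpoly x).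
rewrite (monicP (minCpoly_monic x)) scale1r in Dr.
have [Qs [QsC [s1 Ds genQs]]] := num_field_exists r.
have axQ : SplittingField.axiom Qs.
  exists (map_poly (in_alg Qs) q); first exact: alg_polyOver.
  exists s1 => //.
  have -> : map_poly (in_alg Qs) q = \prod_(y <- s1) ('X - y%:P).
    apply: (map_inj_poly (fmorph_inj QsC)); first exact: rmorph0.
    rewrite rmorph_prod /= -map_poly_comp.
    rewrite (eq_map_poly (g := ratr)); last first.
      by move=> c /=; rewrite alg_num_field fmorph_rat.
    rewrite -Dq Dr -Ds big_map; apply: eq_bigr => y _.
    by rewrite map_polyXsubC.
  exact: eqpxx.
pose Qn : splittingFieldType rat := HB.pack (FieldExt.sort Qs) Qs
   (FieldExt_isSplittingField.Build rat Qs axQ).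
have xr : x \in r by rewrite -root_prod_XsubC -Dr root_minCpoly.
have [x1 _ Dx] : exists2 x1, x1 \in s1 & x = QsC x1.
  by apply/mapP; rewrite Ds.
have galQ : galois 1 {:Qn}.
  rewrite /galois sub1v normalFieldf andbT /=.
  apply/separableP => y _; apply: pcharf0_separable.
  by move=> p; rewrite pchar_lalg pchar_num.
have : (x1 : Qn) \in fixedField 'Gal({:Qn} / 1%AS)%g.
  apply/fixedFieldP; first exact: memvf.
  move=> g _.
  have [nu Dnu] := @extend_algC_subfield_aut Qs QsC g.
  apply: (fmorph_inj QsC).
  by rewrite Dnu -Dx fixx.
rewrite (galois_fixedField galQ) => /vlineP[c ec].
by rewrite Dx ec alg_num_field fmorph_rat Crat_rat.
Qed.

Definition fixes (gens : seq algC) (nu : {rmorphism algC -> algC}) :=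
  forall g, g \in gens -> nu g = g.

Lemma exists_root_seq (g : algC) :
  exists r : seq algC, forall nu : {rmorphism algC -> algC}, nu g \in r.
Proof.
have [r Dr] := closed_field_poly_normal (minCpoly g).
rewrite (monicP (minCpoly_monic g)) scale1r in Dr.
by exists r => nu; rewrite -root_prod_XsubC -Dr -(minCpoly_aut nu) root_minCpoly.
Qed.

Lemma exists_roots_seq (gens : seq algC) :
  exists r : seq algC, forall (nu : {rmorphism algC -> algC}) g,
    g \in gens -> nu g \in r.
Proof.
elim: gens => [|g gens [r IH]]; first by exists [::].
have [r1 h1] := exists_root_seq g; exists (r1 ++ r) => nu h.
by rewrite inE mem_cat => /orP[/eqP ->|/IH ->]; rewrite ?h1 ?orbT.
Qed.

(** The bound makes C' prime to q, so the valuation of C at q is e times that of c. *)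
Lemma ratr_exp_logn (e q : nat) (C C' : int) (c : rat) :
  prime q -> C != 0 -> C' != 0 -> (`|C'| < q)%N ->
  C%:~R = c ^+ e * C'%:~R :> rat -> (e %| logn q `|C|)%N.
Proof.
move=> pq C0 C0' ltq eC.
have d0 : (denq c)%:~R != 0 :> rat by rewrite intr_eq0 denq_neq0.
have c0 : c ^+ e != 0.
  by apply: contraNneq C0 => c0; rewrite -(intr_eq0 rat) eC c0 mul0r.
have eZ : C * denq c ^+ e = numq c ^+ e * C'.
  apply: (@intr_inj rat); rewrite !rmorphM !rmorphXn /= eC.
  by rewrite -[in RHS](divfK d0 (numq c)%:~R) divq_num_den exprMn; ring.
have n0 : (numq c ^+ e != 0).
  rewrite -(intr_eq0 rat) rmorphXn /=; apply: contraNneq c0.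
  by rewrite -[in X in _ -> X](divq_num_den c) expr_div_n => ->; rewrite mul0r.
have := congr1 (fun z => logn q `|z|) eZ.
have nn : (0 < `|numq c| ^ e)%N by rewrite -abszX absz_gt0.
have dn : (0 < `|denq c| ^ e)%N by rewrite expn_gt0 absz_gt0 denq_neq0.
rewrite !abszM !abszX (lognM _ _ dn) ?absz_gt0 // (lognM _ nn) ?absz_gt0 // !lognX.
have -> : logn q `|C'| = 0%N.
  apply/eqP; rewrite -leqn0 leqNgt logn_gt0 mem_primes pq absz_gt0 C0' /=.
  by apply/negP => /dvdn_leq; rewrite absz_gt0 C0' => /(_ isT); lia.
rewrite addn0 => h; have : (e %| logn q `|C| + e * logn q `|denq c|)%N.
  by rewrite h dvdn_mulr.
by rewrite dvdn_addl // dvdn_mulr.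
Qed.

(* If every automorphism fixing gens fixes r, then the Kummer character
   nu |-> nu r / r only depends on the values of nu on gens, and there are
   finitely many such characters.  By pigeonhole, two such r with distinct
   ramification would have a rational quotient. *)
Lemma kummer_move (e : nat) (gens : seq algC) (I : algC -> int -> Prop) :
  (0 < e)%N ->
  (forall r C, I r C -> r ^+ e = C%:~R /\ C != 0) ->
  (forall N : nat, exists r C q,
     [/\ I r C, prime q, (N < q)%N & ~~ (e %| logn q `|C|)%N]) ->
  exists r C nu, [/\ I r C, fixes gens nu & nu r <> r].
Proof.
move=> e0 HI Hq; apply: contrapT => Hn.
have H r C nu : I r C -> fixes gens nu -> nu r = r.
  by move=> h1 h2; apply: contrapT => h3; apply: Hn; exists r, C, nu.
have [z pz] := C_prim_root_exists e0.
have [R HR] := exists_roots_seq gens.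
pose n := size gens.
pose T := {ffun 'I_n -> seq_sub R}.
(* The graph of the Kummer character of r, as a relation between the values of nu on [gens] and the
   exponent of nu r / r. *)
pose code r : {set T * 'I_e} := [set p : T * 'I_e |
   `[< exists2 nu : {rmorphism algC -> algC},
   forall i : 'I_n, nu gens`_i = val (p.1 i) & nu r = z ^+ p.2 * r >]].
have Hcode r C (nu : {rmorphism algC -> algC}) : I r C ->
  exists2 p : T * 'I_e, p \in code r &
   (forall i : 'I_n, nu gens`_i = val (p.1 i)) /\ nu r = z ^+ p.2 * r.
  move=> /HI[rC C0].
  have r0 : r != 0.
    apply: contraNneq C0 => r0; rewrite -(intr_eq0 algC) -rC r0.
    by rewrite expr0n; case: (e) e0.
  have : (nu r / r) ^+ e = 1.
    rewrite expr_div_n -rmorphXn /= rC rmorph_int divff //.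
    by rewrite intr_eq0.
  case/(prim_rootP pz) => k ek.
  have hm (i : 'I_n) : nu gens`_i \in R by apply: HR; rewrite mem_nth.
  pose u : T := [ffun i => SeqSub (hm i)].
  have h1 (i : 'I_n) : nu gens`_i = val (u i) by rewrite ffunE.
  have h2 : nu r = z ^+ k * r by rewrite -ek divfK.
  by exists (u, k) => //; rewrite inE; apply/asboolP; exists nu.
(* One representative r' is chosen for each of the finitely many codes that occur, and N bounds the
   corresponding integers C'. *)
have [N HN] : exists N : nat, forall r C, I r C ->
    exists r' C', [/\ I r' C', code r' = code r & (`|C'| <= N)%N].
  have hS (S : {set T * 'I_e}) : exists N : nat, forall r C, I r C ->
     code r = S -> exists r' C', [/\ I r' C', code r' = S & (`|C'| <= N)%N].
    have [[r [C [h1 h2]]]|no] := pselect (exists r C, I r C /\ code r = S).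
      by exists `|C|%N => _ _ _ _; exists r, C.
    by exists 0%N => r C h1 h2; case: no; exists r, C.
  have [f hf] := fin_all_exists hS.
  exists (\max_S f S)%N => r C h.
  have [r' [C' [h1 h2 h3]]] := hf (code r) r C h erefl.
  by exists r', C'; split=> //; apply: leq_trans h3 (leq_bigmax _).
have [r [C [q [IrC pq Nq /negP]]]] := Hq N; apply.
have [r' [C' [IrC' ecode leC']]] := HN r C IrC.
have [rC C0] := HI _ _ IrC; have [rC' C0'] := HI _ _ IrC'.
have r'0 : r' != 0.
  apply: contraNneq C0' => r0; rewrite -(intr_eq0 algC) -rC' r0.
  by rewrite expr0n; case: (e) e0.
have : r / r' \in Crat.
  apply: aut_fixed_rat => nu; rewrite fmorph_div.
  have [p pin [h1 h2]] := Hcode r C nu IrC.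
  move: pin; rewrite -ecode inE => /asboolP[nu' h1' h2'].
  (* As nu and nu' agree on [gens], they agree on r'. Since nu' multiplies r' by the root of unity
     by which nu multiplies r, the quotient r / r' is fixed by nu. *)
  have : (algC_invaut nu' \o nu) r' = r'.
    apply: (H r' C' (algC_invaut nu' \o nu)) => // g gin /=.
    have lt_i : (index g gens < n)%N by rewrite index_mem.
    rewrite -(nth_index 0 gin) (h1 (Ordinal lt_i)) -(h1' (Ordinal lt_i)).
    exact: algC_autK.
  move/(congr1 nu') => /=; rewrite algC_invautK h2' => ->.
  rewrite h2 invfM mulrACA divff ?mul1r //.
  rewrite expf_neq0 //; apply: contraTneq (oner_neq0 algC) => z0.
  by rewrite -(prim_expr_order pz) z0 expr0n; case: (e) e0 => // k _ /=; rewrite eqxx.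
case/CratP => c ec.
apply: (ratr_exp_logn (c := c) pq C0 C0'); first by lia.
apply: (fmorph_inj (ratr : {rmorphism rat -> algC})).
rewrite rmorphM rmorphXn /= !ratr_int -ec expr_div_n rC' divfK -?rC //.
by rewrite intr_eq0.
Qed.

Definition map_pt (f : algC -> algC) (P : point algC) :=
  if P is Affine x y then Affine (f x) (f y) else Infty.

Definition pt_coords (P : point algC) :=
  if P is Affine x y then [:: x; y] else [::].

Lemma map_pt_fixed gens nu P : fixes gens nu -> {subset pt_coords P <= gens} ->
  map_pt nu P = P.
Proof.
case: P => //= x y fx sub; rewrite !fx //; apply: sub.
  by rewrite !inE eqxx orbT.
by rewrite !inE eqxx.
Qed.

(** The list [gens] stands for the number field that it generates. That a multiple of Q is not
    defined over this field is witnessed by an automorphism moving it. *)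
Definition many_points (W : weierstrass algC) (K : {pred algC}) :=
  forall gens : seq algC, exists2 Q, rational_point W K Q &
    forall m, (0 < m)%N -> exists2 nu : {rmorphism algC -> algC}, fixes gens nu &
      map_pt nu (natmul_pt W Q m) <> natmul_pt W Q m.

Section RatCurve.
Variable W0 : weierstrass rat.
Local Notation W := (map_weierstrass (ratr : rat -> algC) W0).
Implicit Type nu : {rmorphism algC -> algC}.

Lemma map_opp nu P : map_pt nu (opp_pt W P) = opp_pt W (map_pt nu P).
Proof.
by case: P => //= x y; rewrite !rmorphB rmorphN rmorphM /= !fmorph_rat.
Qed.

Lemma map_add nu P Q :
  map_pt nu (add_pt W P Q) = add_pt W (map_pt nu P) (map_pt nu Q).
Proof.
case: P Q => [|x1 y1] [|x2 y2] //=.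
have ey : nu (- y2 - ratr (wa1 W0) * x2 - ratr (wa3 W0)) =
   - nu y2 - ratr (wa1 W0) * nu x2 - ratr (wa3 W0).
  by rewrite !rmorphB rmorphN rmorphM /= !fmorph_rat.
rewrite -ey !(inj_eq (fmorph_inj nu)); case: ifP => //= _.
set l := (if _ then _ else _); set l' := (if _ then _ else _).
have -> : l' = nu l.
  rewrite /l /l'; case: ifP => _; rewrite fmorph_div.
    by congr (_ / _);
      rewrite !(rmorph_nat, fmorph_rat, rmorphB, rmorphD, rmorphXn, rmorphM).
  by rewrite !rmorphB.
by congr Affine; rewrite !(fmorph_rat, rmorphB, rmorphN, rmorphD, rmorphXn, rmorphM).
Qed.

Lemma map_natmul nu P n :
  map_pt nu (natmul_pt W P n) = natmul_pt W (map_pt nu P) n.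
Proof. by elim: n => //= n IH; rewrite map_add IH. Qed.

Lemma map_intmul nu P m :
  map_pt nu (intmul_pt W P m) = intmul_pt W (map_pt nu P) m.
Proof. by case: m => n; rewrite /intmul_pt ?map_opp map_natmul. Qed.

(** Points are added one at a time. In a relation, the multiple of the new point is the opposite of
    a combination of the old ones, hence is fixed by every automorphism fixing their coordinates; so
    its coefficient is 0. *)
Lemma infinite_rank_many_points K : many_points W K -> infinite_rank W K.
Proof.
move=> Hm; elim=> [|n [P [ratP indP]]].
  by exists (fun _ => Infty); split=> [[]|m _ []].
have [Q ratQ HQ] := Hm (flatten [seq pt_coords (P i) | i <- enum 'I_n]).
exists (fun i => if unlift ord0 i is Some j then P j else Q); split=> [i|m].
  by case: unliftP.
rewrite big_ord_recl unlift_none.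
under eq_bigr => i _ do rewrite liftK.
set S := \big[_/_]_i _ => e0.
have fixS nu : fixes (flatten [seq pt_coords (P i) | i <- enum 'I_n]) nu ->
   map_pt nu S = S.
  move=> fnu; rewrite /S; elim/big_rec: _ => // i X _ IH.
  rewrite map_add IH map_intmul (map_pt_fixed fnu) // => g gi.
  by apply/flattenP; exists (pt_coords (P i)); rewrite // map_f // mem_enum.
have [m0 S0] : m ord0 = 0 /\ S = Infty.
  have := e0; case em: (m ord0) => [[|k]|k] e1; first by split.
    have [nu fnu []] := HQ k.+1 isT.
    by rewrite -[natmul_pt _ _ _]/(intmul_pt W Q k.+1) (add_pt_eqInfty e1)
      map_opp fixS.
  have [nu fnu []] := HQ k.+1 isT.
  have := add_pt_eqInfty e1; move/(congr1 (opp_pt W)).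
  by rewrite /intmul_pt !opp_ptK => ->; rewrite fixS.
move=> i; case: (unliftP ord0 i) => [j ->|->] //.
exact: (indP (fun j => m (lift ord0 j)) S0 j).
Qed.

End RatCurve.

(** * Reduction to integral short Weierstrass equations *)

Lemma map_short (a b : int) :
  map_weierstrass (ratr : rat -> algC) (short_eqn a%:~R b%:~R) =
  short_eqn a%:~R b%:~R.
Proof. by rewrite /map_weierstrass /short_eqn /= rmorph0 !ratr_int. Qed.

Lemma map_natmul_short (nu : {rmorphism algC -> algC}) (a b : int) P n :
  map_pt nu (natmul_pt (short_eqn a%:~R b%:~R) P n) =
  natmul_pt (short_eqn a%:~R b%:~R) (map_pt nu P) n.
Proof. by rewrite -map_short map_natmul. Qed.

Section ShortModel.
Variable W0 : weierstrass rat.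
Local Notation W := (map_weierstrass (ratr : rat -> algC) W0).
Local Notation a1 := (wa1 W0).
Local Notation a2 := (wa2 W0).
Local Notation a3 := (wa3 W0).
Local Notation a4 := (wa4 W0).
Local Notation a6 := (wa6 W0).

Definition wb2 : rat := a1 ^+ 2 + 4 * a2.
Definition wb4 : rat := 2 * a4 + a1 * a3.
Definition wb6 : rat := a3 ^+ 2 + 4 * a6.
Definition wc4 : rat := wb2 ^+ 2 - 24 * wb4.
Definition wc6 : rat := - wb2 ^+ 3 + 36 * wb2 * wb4 - 216 * wb6.

(** The classical model y^2 = x^3 - 27 c4 x - 54 c6, rescaled by u in order to have integral
    coefficients. *)
Definition is_short_model (u : rat) (a b : int) :=
  [/\ u != 0, a%:~R = - 27 * wc4 * u ^+ 4 & b%:~R = - 54 * wc6 * u ^+ 6].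

Variables (u : rat) (a b : int).
Hypothesis model : is_short_model u a b.
Local Notation S := (short_eqn a%:~R b%:~R : weierstrass algC).

(** Together with [phi_y], this inverts the substitution that sends (x, y) to (u^2 (36 x + 3 b2),
    108 u^3 (2 y + a1 x + a3)). *)
Definition phi_x (x : algC) : algC :=
  (x / ratr u ^+ 2 - 3 * ratr wb2) / 36.
Definition phi_y (x y : algC) : algC :=
  (y / (108 * ratr u ^+ 3) - ratr a1 * phi_x x - ratr a3) / 2.
Definition phi (P : point algC) :=
  if P is Affine x y then Affine (phi_x x) (phi_y x y) else Infty.

Lemma scale_neq0 : ratr u != 0 :> algC.
Proof. by rewrite fmorph_eq0; case: model. Qed.

Lemma short_aE : a%:~R = - 27 * ((ratr a1 ^+ 2 + 4 * ratr a2) ^+ 2 -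
   24 * (2 * ratr a4 + ratr a1 * ratr a3)) * ratr u ^+ 4 :> algC.
Proof. by case: model => _ ea _; rewrite -(ratr_int _ a) ea /wc4 /wb2 /wb4; ring. Qed.

Lemma short_bE : b%:~R = - 54 * (- (ratr a1 ^+ 2 + 4 * ratr a2) ^+ 3
   + 36 * (ratr a1 ^+ 2 + 4 * ratr a2) * (2 * ratr a4 + ratr a1 * ratr a3)
   - 216 * (ratr a3 ^+ 2 + 4 * ratr a6)) * ratr u ^+ 6 :> algC.
Proof.
by case: model => _ _ eb; rewrite -(ratr_int _ b) eb /wc6 /wb2 /wb4 /wb6; ring.
Qed.

Lemma ratr_wb2 : ratr wb2 = ratr a1 ^+ 2 + 4 * ratr a2 :> algC.
Proof. by rewrite /wb2; ring. Qed.

Lemma phi_x_inj : injective phi_x.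
Proof.
move=> x x' /(mulIf (invr_neq0 _)) h.
have /h : (36 : algC) != 0 by rewrite pnatr_eq0.
by move/addIr/(mulIf (invr_neq0 (expf_neq0 2 scale_neq0))).
Qed.

Lemma phi_y_inj x : injective (phi_y x).
Proof.
move=> y y' /(mulIf (invr_neq0 _)) h.
have /h : (2 : algC) != 0 by rewrite pnatr_eq0.
move/addIr/addIr/(mulIf (invr_neq0 _)); apply.
by rewrite mulf_neq0 ?expf_neq0 ?scale_neq0 ?pnatr_eq0.
Qed.

Lemma phi_inj : injective phi.
Proof. by case=> [|x y] [|x' y'] //= [/phi_x_inj -> /phi_y_inj ->]. Qed.

Lemma phi_on P : on_curve S P -> on_curve W (phi P).
Proof.
case: P => // x y; rewrite on_shortE => /eqP ey /=.
rewrite -subr_eq0; apply/eqP.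
transitivity ((y ^+ 2 - (x ^+ 3 + a%:~R * x + b%:~R)) / (216 * ratr u ^+ 3) ^+ 2).
  by rewrite short_aE short_bE /phi_y /phi_x ratr_wb2; field; rewrite scale_neq0.
by rewrite ey subrr mul0r.
Qed.

Lemma phi_add P Q : on_curve S P -> on_curve S Q ->
  phi (add_pt S P Q) = add_pt W (phi P) (phi Q).
Proof.
case: P Q => [|x1 y1] [|x2 y2] // c1 c2.
have eopp : (- phi_y x2 y2 - ratr a1 * phi_x x2 - ratr a3) = phi_y x2 (- y2).
  by rewrite /phi_y; field; rewrite scale_neq0.
have [/andP[/eqP -> /eqP ->]|no] := boolP ((x1 == x2) && (y1 == - y2)).
  by rewrite add_short_oppl /= eopp !eqxx.
have [l [s1 s2] ->] := slope_ex two_neq0C c1 c2 no.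
have no' : (phi_x x1 == phi_x x2) && (phi_y x1 y1 == phi_y x2 (- y2)) = false.
  apply: negbTE; apply: contra no => /andP[/eqP/phi_x_inj -> /eqP/phi_y_inj ->].
  by rewrite !eqxx.
rewrite /= eopp no'.
set l' := (if _ then _ else _).
(* The affine substitution maps lines to lines, with this effect on slopes; tangents and chords are
   checked separately. *)
have el' : l' = l / (6 * ratr u) - ratr a1 / 2.
  rewrite /l' (inj_eq phi_x_inj); case: eqP => [ex|nx].
    have yn : y1 != 0.
      apply/negP => /eqP y0; move: c2 no; rewrite -ex on_shortE.
      move: c1; rewrite on_shortE => /eqP <-; rewrite y0 expr0n /= sqrf_eq0.
      by move/eqP ->; rewrite !eqxx oppr0 eqxx.
    have ey : y2 = y1.
      by move: s1; rewrite ex subrr mulr0 => /esym/eqP; rewrite subr_eq0 => /eqP.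
    have -> : l = (3 * x1 ^+ 2 + a%:~R) / (2 * y1).
      apply: (canRL (mulfK _)); first by rewrite mulf_neq0 ?two_neq0C.
      have -> : l * (2 * y1) = l * (y1 + y2) by rewrite ey; ring.
      by rewrite s2 -ex; ring.
    have -> : 2 * phi_y x1 y1 + ratr a1 * phi_x x1 + ratr a3 =
      y1 / (108 * ratr u ^+ 3) by rewrite /phi_y; field; rewrite scale_neq0.
    by rewrite short_aE /phi_y /phi_x ratr_wb2; field; rewrite scale_neq0 yn.
  have hx : x2 - x1 != 0 by rewrite subr_eq0; apply/eqP => e; apply: nx.
  have -> : l = (y2 - y1) / (x2 - x1).
    by apply: (canRL (mulfK hx)); rewrite -opprB mulrN s1 opprB.
  have -> : phi_x x2 - phi_x x1 = (x2 - x1) / (36 * ratr u ^+ 2).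
    by rewrite /phi_x; field; rewrite scale_neq0.
  by rewrite /phi_y /phi_x; field; rewrite scale_neq0 hx.
rewrite el'; congr Affine; rewrite /phi_y /phi_x ratr_wb2; field; by rewrite scale_neq0.
Qed.

Lemma phi_natmul P n : on_curve S P ->
  phi (natmul_pt S P n) = natmul_pt W (phi P) n.
Proof.
move=> cP; elim: n => // n IH.
rewrite [in RHS]/natmul_pt /= -[iter _ _ _]/(natmul_pt _ _ _).
by rewrite -IH -phi_add // on_natmul.
Qed.

Lemma map_phi (nu : {rmorphism algC -> algC}) P :
  map_pt nu (phi P) = phi (map_pt nu P).
Proof.
case: P => //= x y; congr Affine; rewrite /phi_y /phi_x.
  by rewrite !(rmorph_nat, fmorph_rat, fmorphV, rmorphXn, rmorphB, rmorphM).
by rewrite !(rmorph_nat, fmorph_rat, fmorphV, rmorphXn, rmorphB, rmorphM).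
Qed.

Lemma many_points_short (sigma : {rmorphism algC -> algC}) :
  many_points S [pred x | sigma x == x] -> many_points W [pred x | sigma x == x].
Proof.
move=> H gens; have [Q /andP[cQ rQ] hQ] := H gens.
exists (phi Q); first apply/andP; first split; first exact: phi_on.
  case: Q cQ rQ {hQ} => //= x y _ /andP[/eqP ex /eqP ey].
  have := map_phi sigma (Affine x y); rewrite /= ex ey => -[e1 e2].
  by rewrite !inE e1 e2 !eqxx.
move=> m m0; have [nu fnu hnu] := hQ m m0; exists nu => //.
by rewrite -phi_natmul // map_phi => /phi_inj.
Qed.

End ShortModel.

(** This carries smoothness over to the short model when u is nonzero. *)
Lemma short_disc (W : weierstrass rat) (u : rat) :
  4 * (- 27 * wc4 W * u ^+ 4) ^+ 3 + 27 * (- 54 * wc6 W * u ^+ 6) ^+ 2 =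
  - (2 ^+ 8 * 3 ^+ 12 * u ^+ 12 * discriminant W).
Proof.
by case: W => a1 a2 a3 a4 a6; rewrite /wc4 /wc6 /wb2 /wb4 /wb6 /=; ring.
Qed.

Lemma short_model (E : elliptic_curve rat) (sigma : {rmorphism algC -> algC}) :
  (forall a b : int, 4 * a ^+ 3 + 27 * b ^+ 2 != 0 ->
     many_points (short_eqn a%:~R b%:~R) [pred x | sigma x == x]) ->
  many_points (map_weierstrass ratr (ec_eqn E)) [pred x | sigma x == x].
Proof.
move=> H; pose W := ec_eqn E.
pose u : rat := (denq (wc4 W) * denq (wc6 W))%:~R.
have n4 : (denq (wc4 W))%:~R != 0 :> rat by rewrite intr_eq0 denq_neq0.
have n6 : (denq (wc6 W))%:~R != 0 :> rat by rewrite intr_eq0 denq_neq0.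
pose a : int := - 27 * numq (wc4 W) * denq (wc4 W) ^+ 3 * denq (wc6 W) ^+ 4.
pose b : int := - 54 * numq (wc6 W) * denq (wc6 W) ^+ 5 * denq (wc4 W) ^+ 6.
have model : is_short_model W u a b.
  split; first by rewrite intr_eq0 mulf_neq0 ?denq_neq0.
    rewrite -[in RHS](divq_num_den (wc4 W)) /a /u.
    by move: (denq _) (denq _) (numq _) n4 n6 => x y z hx hy; field.
  rewrite -[in RHS](divq_num_den (wc6 W)) /b /u.
  by move: (denq _) (denq _) (numq _) n4 n6 => x y z hx hy; field.
apply: (many_points_short model); apply: H.
case: (model) => un ea eb; rewrite -(intr_eq0 rat).
have -> : (4 * a ^+ 3 + 27 * b ^+ 2)%:~R = 4 * a%:~R ^+ 3 + 27 * b%:~R ^+ 2 :> rat.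
  by ring.
rewrite ea eb short_disc {ea eb}.
by rewrite oppr_eq0 !mulf_neq0 ?expf_neq0 // ec_smooth.
Qed.

(** * Square classes over the fixed field *)

Section KummerCharacter.
Variables (sigma : {rmorphism algC -> algC}) (e : nat).
Hypothesis e_gt0 : (0 < e)%N.
Hypothesis sigma_mu : forall z : algC, z ^+ e = 1 -> sigma z = z.

(** The Kummer character of c evaluated at sigma. As sigma fixes the e-th roots of unity, the choice
    of the root r does not matter ([chi_root]), and the value 1 means that c is an e-th power in the
    fixed field. *)
Definition chi (c : int) : algC :=
  let r := e.-root (c%:~R : algC) in sigma r / r.

Lemma chi_root c r : c != 0 -> r ^+ e = c%:~R -> chi c = sigma r / r.
Proof.
move=> c0 er; rewrite /chi; set s := e.-root _.
have es : s ^+ e = c%:~R by rewrite rootCK.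
have [r0 s0] : r != 0 /\ s != 0.
  split; apply: contraNneq c0 => z0; rewrite -(intr_eq0 algC).
    by rewrite -er z0 expr0n; case: (e) e_gt0.
  by rewrite -es z0 expr0n; case: (e) e_gt0.
have : (s / r) ^+ e = 1 by rewrite expr_div_n es er divff // intr_eq0.
move/sigma_mu; rewrite fmorph_div => h.
have sr0 : sigma r != 0 by rewrite fmorph_eq0.
have -> : sigma s = s / r * sigma r by rewrite -h divfK.
by field; rewrite r0 s0.
Qed.

Lemma chiM c d : c != 0 -> d != 0 -> chi (c * d) = chi c * chi d.
Proof.
move=> c0 d0; have cd0 : c * d != 0 by rewrite mulf_neq0.
rewrite (@chi_root (c * d) (e.-root c%:~R * e.-root d%:~R)) //.
  by rewrite rmorphM invfM mulrACA.
by rewrite exprMn !rootCK // rmorphM.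
Qed.

Lemma chi_exp c : c != 0 -> chi (c ^+ e) = 1.
Proof.
move=> c0; rewrite (@chi_root _ c%:~R) ?expf_neq0 ?rmorphXn //.
by rewrite rmorph_int divff // intr_eq0.
Qed.

Lemma chi_expe c : c != 0 -> chi c ^+ e = 1.
Proof.
move=> c0; rewrite expr_div_n -rmorphXn /= rootCK // rmorph_int divff //.
by rewrite intr_eq0.
Qed.

Lemma chi_eq1 c : c != 0 -> chi c = 1 ->
  exists2 r : algC, r ^+ e = c%:~R & sigma r = r.
Proof.
move=> c0 hc; exists (e.-root c%:~R); first by rewrite rootCK.
have r0 : e.-root (c%:~R : algC) != 0.
  by rewrite rootC_eq0 // intr_eq0.
by rewrite -[LHS](divfK r0) -/(chi c) hc mul1r.
Qed.

End KummerCharacter.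

Lemma sigma_mu2 (sigma : {rmorphism algC -> algC}) (z : algC) :
  z ^+ 2 = 1 -> sigma z = z.
Proof. by move/eqP; rewrite sqrf_eq1 => /orP[] /eqP ->; rewrite ?rmorphN rmorph1. Qed.

Lemma chi2_cases (sigma : {rmorphism algC -> algC}) c : c != 0 ->
  chi sigma 2 c = 1 \/ chi sigma 2 c = - 1.
Proof.
move/(chi_expe sigma (isT : 0 < 2)%N)/eqP.
by rewrite sqrf_eq1 => /orP[] /eqP ->; [left | right].
Qed.

(** * Points with rational x and quadratic y *)

Section QuadraticPoints.
Variables (sigma : {rmorphism algC -> algC}) (a b : int).
Hypothesis disc_neq0 : 4 * a ^+ 3 + 27 * b ^+ 2 != 0.
Local Notation W := (short_eqn a%:~R b%:~R : weierstrass algC).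
Local Notation chi := (chi sigma 2).

(** The integer C records the square class of f(x): its character decides whether y lies in the
    fixed field, and its odd valuation at q makes the square root of C ramified there. *)
Definition quad_point (N : nat) (x : rat) (C : int) :=
  [/\ small2 (ratr x), C != 0, chi C = 1,
      exists2 rho : rat, rho != 0 & x ^+ 3 + a%:~R * x + b%:~R = C%:~R * rho ^+ 2
    & exists2 q : nat, prime q && (N < q)%N & odd (logn q `|C|) ].

(** An automorphism moving the square root r of C sends P = (x, rho r) to - P. If it fixed m P, then
    2 m P would be 0, although P is nontorsion. *)
Lemma many_points_quad : (forall N, exists x C, quad_point N x C) ->
  many_points W [pred x | sigma x == x].
Proof.
move=> H gens.
pose I (r : algC) (C : int) := exists x : rat, exists rho : rat,
  [/\ small2 (ratr x), x ^+ 3 + a%:~R * x + b%:~R = C%:~R * rho ^+ 2,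
      r ^+ 2 = C%:~R, C != 0 & sigma r = r].
have HI r C : I r C -> r ^+ 2 = C%:~R /\ C != 0 by case=> x [rho []].
have Hq N : exists r C q,
  [/\ I r C, prime q, (N < q)%N & ~~ (2 %| logn q `|C|)%N].
  have [x [C [sx C0 hC [rho rho0 ex] [q /andP[pq Nq] oq]]]] := H N.
  have [r er sr] := chi_eq1 (e := 2) isT C0 hC.
  by exists r, C, q; rewrite dvdn2 oq; split=> //; exists x, rho.
have [r [C [nu [[x [rho [sx ex er C0 sr]]] fnu nur]]]] :=
  kummer_move (e := 2) gens isT HI Hq.
have c : on_curve W (Affine (ratr x) (ratr rho * r)).
  rewrite on_shortE exprMn er -(ratr_int _ C) -(ratr_int _ a) -(ratr_int _ b).
  by rewrite -!rmorphXn -!rmorphM -!rmorphD /= ex mulrC.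
exists (Affine (ratr x) (ratr rho * r)).
  by rewrite /rational_point c /= !inE fmorph_rat rmorphM fmorph_rat sr !eqxx.
move=> m m0; exists nu => //; rewrite map_natmul_short.
have -> : map_pt nu (Affine (ratr x) (ratr rho * r)) =
   opp_pt W (Affine (ratr x) (ratr rho * r)).
  rewrite opp_shortE /= fmorph_rat rmorphM fmorph_rat.
  have : (nu r) ^+ 2 = r ^+ 2 by rewrite -rmorphXn /= er rmorph_int.
  by move/eqP; rewrite eqf_sqr => /orP[] /eqP // ->; rewrite mulrN.
rewrite natmul_opp ?two_neq0C ?disc_neq0C // => h.
apply: (small2_nontorsion disc_neq0 c sx (n := (m + m)%N)); first by lia.
rewrite natmulD ?two_neq0C ?disc_neq0C // -{2}h.
exact: add_ptN.
Qed.

End QuadraticPoints.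

(** * Integers prime to q, and rational numbers close to infinity above 2 *)

Local Notation ndvd q c := (~~ dvdn q (absz c%R)).

Lemma ndvd_small (q : nat) (c : int) : c != 0 -> (`|c| < q)%N -> ndvd q c.
Proof.
by move=> c0 lt_cq; apply/negP => /dvdn_leq; rewrite absz_gt0 c0 => /(_ isT); lia.
Qed.

Lemma ndvdM (q : nat) (c d : int) : prime q ->
  ndvd q c -> ndvd q d -> ndvd q (c * d).
Proof. by move=> pq hc hd; rewrite abszM Euclid_dvdM // negb_or hc. Qed.

Lemma ndvdMl (q : nat) (c d : int) : ndvd q (c * d) -> ndvd q c /\ ndvd q d.
Proof.
rewrite abszM => h.
by split; apply: contra h => h; [apply: dvdn_mulr | apply: dvdn_mull].
Qed.

Lemma ndvdX (q : nat) (c : int) n : prime q ->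
  ndvd q c -> ndvd q (c ^+ n).
Proof. by move=> pq hc; rewrite abszX Euclid_dvdX // negb_and hc. Qed.

Lemma ndvdD (q : nat) (c d : int) :
  ndvd q c -> ndvd q (c + q%:Z * d).
Proof.
move=> hc; apply: contra hc.
rewrite -![dvdn q (absz _)]/(q%:Z %| _)%Z rpredDr //.
by rewrite dvdz_mulr.
Qed.

Lemma ndvd1D (q : nat) (d : int) : prime q -> ndvd q (1 + q%:Z * d).
Proof. by move=> pq; apply: ndvdD; rewrite dvdn1 neq_ltn prime_gt1 ?orbT. Qed.

Lemma logn_primeM (q : nat) (c : int) : prime q -> ndvd q c ->
  logn q (absz (q%:Z * c)) = 1%N /\ q%:Z * c != 0.
Proof.
move=> pq hc; have c0 : (0 < `|c|)%N by rewrite lt0n; apply: contraNneq hc => ->.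
have q0 := prime_gt0 pq; split; last by rewrite mulf_neq0 // -absz_gt0.
by rewrite abszM lognM // logn_prime // eqxx lognE pq c0 (negPf hc).
Qed.

Lemma small2_rat (x : rat) (n d : int) : odd (absz d) -> n != 0 ->
  x^-1 = 4 * n%:~R / d%:~R -> small2 (ratr x).
Proof.
move=> od n0 ex.
have d0 : d != 0 by apply: contraTneq od => ->.
have x0 : x != 0.
  rewrite -invr_eq0 ex !mulf_neq0 ?invr_eq0 ?intr_eq0 //.
rewrite /small2 fmorph_eq0 x0 -fmorphV ex /=.
have -> : ratr (4 * n%:~R / d%:~R) / 4 = n%:~R * d%:~R^-1 :> algC.
  rewrite fmorph_div rmorphM /= !ratr_int ratr_nat.
  by field; rewrite intr_eq0 d0.
by rewrite rpredM ?rpred_int // A2_odd_int_inv.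
Qed.

Lemma m1D4_neq0 (k : int) : -1 + 4 * k != 0. Proof. lia. Qed.

Lemma odd_1D2 (k : int) : odd (absz (1 + 2 * k)). Proof. lia. Qed.

(** * Rational parameters for b = 0 and for a b nonzero *)

Lemma KW_value (F : fieldType) (a b U V : F) : a != 0 -> V != 0 ->
  let x := - (b * U) / (a * V) in
  x ^+ 3 + a * x + b =
  a * b * V * (- b ^+ 2 * U ^+ 3 - a ^+ 3 * U * V ^+ 2 + a ^+ 3 * V ^+ 3) *
  ((a * V) ^- 2) ^+ 2.
Proof. by move=> a0 V0 x; rewrite /x; field; rewrite a0 V0. Qed.

(** In f(t x) = t^3 f(x) the cubic terms cancel. What remains is linear in x, and its solution,
    after division by t - 1, is this x. *)
Lemma KW_twist (F : fieldType) (a b t : F) : a != 0 -> t != 0 -> 1 + t != 0 ->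
  let x := - (b * (1 + t * (1 + t))) / (a * (t * (1 + t))) in
  (t * x) ^+ 3 + a * (t * x) + b = t ^+ 3 * (x ^+ 3 + a * x + b).
Proof. by move=> a0 t0 t1 x; rewrite /x; field; rewrite a0 t0 t1. Qed.

Section Cases.
Variables (sigma : {rmorphism algC -> algC}) (a b : int).
Local Notation chi := (chi sigma 2).
Local Notation quad_point := (quad_point sigma a b).

Let chiM := chiM (isT : (0 < 2)%N) (@sigma_mu2 sigma).
Let chi_sqr := chi_exp (isT : (0 < 2)%N) (@sigma_mu2 sigma).

(* The class modulo squares of x^3 + a x for 1 / x = (z1 + z2) / (1 - a z1 z2). *)
Definition class1728 (z1 z2 : int) : int :=
  (z1 + z2) * (1 - a * z1 * z2) * (1 + a * z1 ^+ 2) * (1 + a * z2 ^+ 2).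

(** The factor z1 + z2 contributes q exactly once, and the other factors are congruent to 1 modulo
    q. *)
Lemma class1728_logn (q : nat) (w1 w2 : int) : prime q ->
  ndvd q (4 * (w1 + w2)) ->
  let C := class1728 (4 * q%:Z * w1) (4 * q%:Z * w2) in logn q (absz C) = 1%N /\ C != 0.
Proof.
move=> pq hw; rewrite /=.
have -> : class1728 (4 * q%:Z * w1) (4 * q%:Z * w2) = q%:Z * (4 * (w1 + w2) *
   (1 + q%:Z * (- 16 * a * q%:Z * w1 * w2)) * (1 + q%:Z * (16 * a * q%:Z * w1 ^+ 2))
   * (1 + q%:Z * (16 * a * q%:Z * w2 ^+ 2))) by rewrite /class1728; ring.
by apply: logn_primeM => //; do 3! [apply: ndvdM => //; last exact: ndvd1D].
Qed.

(** This rests on (1 + a z1^2) (1 + a z2^2) = (1 - a z1 z2)^2 + a (z1 + z2)^2, which factors x^2 + a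
    for x = (1 - a z1 z2) / (z1 + z2). *)
Lemma quad_point_1728 N (q : nat) (w1 w2 : int) : b = 0 -> prime q -> (N < q)%N ->
  ndvd q (4 * (w1 + w2)) ->
  chi (class1728 (4 * q%:Z * w1) (4 * q%:Z * w2)) = 1 ->
  exists x C, quad_point N x C.
Proof.
move=> b0 pq Nq hw hC; have [lC C0] := class1728_logn pq hw.
have s0 : w1 + w2 != 0.
  by apply: contraNneq hw => ->; rewrite mulr0.
have q0 : q%:Z != 0 by have := prime_gt0 pq; case: (q).
set z1 := 4 * q%:Z * w1 in hC lC C0; set z2 := 4 * q%:Z * w2 in hC lC C0.
have d0 : 1 - a * z1 * z2 != 0.
  by apply: contraNneq C0 => h; rewrite /class1728 h mulr0 !mul0r.
have zz0 : z1 + z2 != 0 by apply: contraNneq C0 => h; rewrite /class1728 h !mul0r.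
exists ((1 - a * z1 * z2)%:~R / (z1 + z2)%:~R), (class1728 z1 z2); split=> //.
- apply: (@small2_rat _ (q%:Z * (w1 + w2)) (1 - a * z1 * z2)).
  + by rewrite /z1; lia.
  + by rewrite mulf_neq0.
  + by rewrite invf_div; congr (_ / _); rewrite /z1 /z2; ring.
- exists ((z1 + z2)%:~R ^- 2); first by rewrite invr_eq0 expf_neq0 // intr_eq0.
  rewrite b0 /class1728; rewrite -(intr_eq0 rat) in zz0.
  move: z1 z2 zz0 {hC lC C0 d0} => z1 z2 zz0; field.
  by move: zz0; rewrite rmorphD.
- by exists q; rewrite ?pq ?Nq // lC.
Qed.

Lemma chi_six c1 c2 c3 c4 c5 c6 s Y : c1 != 0 -> c2 != 0 -> c3 != 0 ->
  c4 != 0 -> c5 != 0 -> c6 != 0 -> s != 0 -> Y != 0 ->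
  c1 * (c2 * (c3 * (c4 * (c5 * c6)))) = s * Y ^+ 2 ->
  chi c1 = - 1 -> chi c2 = - 1 -> chi c3 = - 1 -> chi c4 = - 1 ->
  chi c5 = - 1 -> chi c6 = - 1 -> chi s = 1.
Proof.
move=> n1 n2 n3 n4 n5 n6 s0 Y0 /(congr1 chi) e h1 h2 h3 h4 h5 h6.
rewrite (chiM s0 (expf_neq0 2 Y0)) chi_sqr // mulr1 in e.
by rewrite -e !chiM ?mulf_neq0 // h1 h2 h3 h4 h5 h6; ring.
Qed.

(** If no parameter worked, all admissible values of [class1728] would be nonsquares, and a first
    one would serve as t. Six others would then have a nonsquare product, whereas six characters
    equal to -1 multiply to 1. *)
Lemma quad_points_1728 : b = 0 -> forall N, exists x C, quad_point N x C.
Proof.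
move=> b0 N; apply: contrapT => Hn.
have hn q w1 w2 : prime q -> (N < q)%N -> ndvd q (4 * (w1 + w2)) ->
    chi (class1728 (4 * q%:Z * w1) (4 * q%:Z * w2)) = - 1.
  move=> pq Nq hw; have [_ C0] := class1728_logn pq hw.
  by case: (chi2_cases sigma C0) => // hC; case: Hn; apply: quad_point_1728 hC.
have [t t0 ht] : exists2 t : int, t != 0 & chi t = - 1.
  have [q Nq pq] := prime_above (N + 4)%N.
  have hq : ndvd q (4 * (1 + 0)) by apply: ndvd_small => //; lia.
  have [_ C0] := class1728_logn pq hq.
  by eexists; last apply: hn (hq) => //; [exact: C0 | lia].
(* {3 A r, B r} and {A r, 3 B r} have the same product, while the ratio of
   their sums 8 r and 8 s r is the nonsquare s. *)
pose s := 4 * t; pose A := 3 - s; pose B := 3 * s - 1.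
(* As s is a multiple of 4, neither s = 3 nor 3 s = 1 is possible. *)
have A0 : A != 0 by rewrite /A /s; lia.
have B0 : B != 0 by rewrite /B /s; lia.
have s0 : s != 0 by rewrite /s mulf_neq0.
have e0 : 4 * (3 * A + 0) * (4 * (B + 0)) * (4 * (3 * A + B)) *
   (4 * (3 * B + 0)) * (4 * (A + 0)) * (4 * (3 * B + A)) != 0.
  have -> : 3 * A + B = 8 by rewrite /A /B; ring.
  have -> : 3 * B + A = 8 * s by rewrite /A /B; ring.
  by rewrite !addr0 !mulf_neq0.
have [q Nq pq] := prime_above (N + absz (4 * (3 * A + 0) * (4 * (B + 0)) *
  (4 * (3 * A + B)) * (4 * (3 * B + 0)) * (4 * (A + 0)) * (4 * (3 * B + A)))%R)%N.
have := ndvd_small e0 (leq_ltn_trans (leq_addl _ _) Nq).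
have {}Nq := leq_ltn_trans (leq_addr _ _) Nq.
rewrite {e0} => /ndvdMl[/ndvdMl[/ndvdMl[/ndvdMl[/ndvdMl[h1 h2] h3] h4] h5] h6].
pose r := 4 * q%:Z.
(* In each triple, the quadratic factors of the class of the pair recur in the two single classes.
   Up to squares there remains 24 A B r^3 (1 - 3 a A B r^2), with an additional s in the second
   triple. *)
pose Y := 24 * A * B * r ^+ 3 * (1 - 3 * a * A * B * r ^+ 2) *
  (1 + 9 * a * A ^+ 2 * r ^+ 2) * (1 + a * B ^+ 2 * r ^+ 2) *
  (1 + 9 * a * B ^+ 2 * r ^+ 2) * (1 + a * A ^+ 2 * r ^+ 2).
have eY : class1728 (r * (3 * A)) (r * 0) * (class1728 (r * B) (r * 0) *
   (class1728 (r * (3 * A)) (r * B) * (class1728 (r * (3 * B)) (r * 0) *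
   (class1728 (r * A) (r * 0) * class1728 (r * (3 * B)) (r * A))))) = s * Y ^+ 2.
  by rewrite /Y /class1728 /A /B; ring.
have [_ n1] := class1728_logn pq h1; have [_ n2] := class1728_logn pq h2.
have [_ n3] := class1728_logn pq h3; have [_ n4] := class1728_logn pq h4.
have [_ n5] := class1728_logn pq h5; have [_ n6] := class1728_logn pq h6.
rewrite -/r in n1 n2 n3 n4 n5 n6.
have Y0 : Y != 0.
  have : s * Y ^+ 2 != 0 by rewrite -eY; do 5! apply: (mulf_neq0 _) => //.
  by rewrite mulf_eq0 negb_or sqrf_eq0 => /andP[].
have := chi_six n1 n2 n3 n4 n5 n6 s0 Y0 eY.
rewrite !hn // => /(_ erefl erefl erefl erefl erefl erefl).
rewrite /s -[4]/((2 : int) ^+ 2) chiM ?expf_neq0 // chi_sqr // mul1r ht => /eqP.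
by rewrite eq_sym -addr_eq0 -mulr2n pnatr_eq0.
Qed.

Lemma quad_points_generic : a != 0 -> b != 0 -> forall N, exists x C, quad_point N x C.
Proof.
move=> a0 b0 N.
have [q Nq pq] := prime_above (N + absz a + absz b + 4)%N.
have NQ : (N < q)%N by lia.
have qn0 : q%:Z != 0 by have := prime_gt0 pq; case: (q).
have qa : ndvd q a by apply: ndvd_small => //; lia.
have qb : ndvd q b by apply: ndvd_small => //; lia.
have q4 : ndvd q (4%:Z) by apply: ndvd_small => //; lia.
have q1 : ndvd q (-1 : int) by apply: ndvd_small => //; lia.
have q2 : ndvd q (2 : int) by apply: ndvd_small => //; lia.
(* If such a t is a nonsquare, then 1 + t = 4 b q m makes V divisible by q exactly once. The classes
   of f(x) and f(t x) are C and t C, and one of them is trivial because their characters are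
   opposite. *)
have [[m qm ht]|Hn] := pselect (exists2 m : int, ndvd q m &
    chi (-1 + 4 * b * q%:Z * m) = - 1).
  pose t := -1 + 4 * b * q%:Z * m.
  have m0 : m != 0 by apply: contraNneq qm => ->.
  have t0 : t != 0.
    by rewrite /t -!mulrA m1D4_neq0.
  have t1 : 1 + t != 0.
    have -> : 1 + t = 4 * b * q%:Z * m by rewrite /t; ring.
    by rewrite !mulf_neq0.
  pose V := t * (1 + t); pose U := 1 + V.
  pose H := - b ^+ 2 * U ^+ 3 - a ^+ 3 * U * V ^+ 2 + a ^+ 3 * V ^+ 3.
  pose C := a * b * V * H.
  have eV : V = q%:Z * (4 * b * m * t) by rewrite /V {2}/t; ring.
  have qt : ndvd q t.
    have -> : t = -1 + q%:Z * (4 * b * m) by rewrite /t; ring.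
    exact: ndvdD.
  have qU : ndvd q U by rewrite /U eV ndvd1D.
  have qH : ndvd q H.
    have -> : H = -1 * b ^+ 2 * U ^+ 3 + q%:Z * ((4 * b * m * t) *
      (- a ^+ 3 * U * V + a ^+ 3 * V ^+ 2)).
      by rewrite mulrA -eV /H; ring.
    by apply: ndvdD; rewrite !(ndvdM, ndvdX).
  have eC : C = q%:Z * (a * b * (4 * b * m * t) * H) by rewrite /C eV; ring.
  have [lC C0] : logn q (absz C) = 1%N /\ C != 0.
    by rewrite eC; apply: logn_primeM => //; rewrite !ndvdM.
  have [lC' C0'] : logn q (absz (t * C)) = 1%N /\ t * C != 0.
    have -> : t * C = q%:Z * (t * (a * b * (4 * b * m * t) * H)).
      by rewrite eC; ring.
    by apply: logn_primeM => //; rewrite !ndvdM.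
  have oU : odd (absz U).
    have -> : U = 1 + 2 * (q%:Z * (2 * b * m * t)) by rewrite /U eV; ring.
    exact: odd_1D2.
  have U0 : U != 0 by apply: contraTneq oU => ->.
  have V0 : V != 0 by rewrite mulf_neq0.
  have aq : (a%:~R : rat) != 0 by rewrite intr_eq0.
  have bq : (b%:~R : rat) != 0 by rewrite intr_eq0.
  have tq : (t%:~R : rat) != 0 by rewrite intr_eq0.
  have Vq : (V%:~R : rat) != 0 by rewrite intr_eq0.
  have Uq : (U%:~R : rat) != 0 by rewrite intr_eq0.
  have eVb : V%:~R = 4 * b%:~R * q%:~R * m%:~R * t%:~R :> rat.
    by rewrite eV; ring.
  pose x : rat := - (b%:~R * U%:~R) / (a%:~R * V%:~R).
  pose rho : rat := (a%:~R * V%:~R) ^- 2.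
  have fx : x ^+ 3 + a%:~R * x + b%:~R = C%:~R * rho ^+ 2.
    rewrite /x KW_value //; congr (_ * _).
    by rewrite /C /H; ring.
  have ftx : (t%:~R * x) ^+ 3 + a%:~R * (t%:~R * x) + b%:~R =
     (t * C)%:~R * (t%:~R * rho) ^+ 2.
    have -> : (t * C)%:~R * (t%:~R * rho) ^+ 2 = t%:~R ^+ 3 * (C%:~R * rho ^+ 2).
      by rewrite rmorphM /=; ring.
    rewrite -fx /x.
    have -> : V%:~R = t%:~R * (1 + t%:~R) :> rat by rewrite /V; ring.
    have -> : U%:~R = 1 + t%:~R * (1 + t%:~R) :> rat by rewrite /U /V; ring.
    apply: KW_twist => //; rewrite -(intr_eq0 rat) in t1.
    by move: t1; rewrite rmorphD.
  have [hC|hC] := chi2_cases sigma C0.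
    exists x, C; split=> //.
    - apply: (@small2_rat _ (- a * t * q%:Z * m) U) => //.
        by rewrite !mulf_neq0 ?oppr_eq0.
      by rewrite /x invf_div eVb; field; rewrite ?Uq ?bq.
    - by exists rho => //; rewrite invr_eq0 expf_neq0 // mulf_neq0.
    - by exists q; [rewrite pq | rewrite lC].
  exists (t%:~R * x), (t * C); split=> //.
  - apply: (@small2_rat _ (- a * q%:Z * m) U) => //.
      by rewrite !mulf_neq0 ?oppr_eq0.
    by rewrite /x invfM invf_div eVb; field; rewrite ?Uq ?bq ?tq.
  - by rewrite chiM // ht hC; ring.
  - by exists (t%:~R * rho) => //; rewrite mulf_neq0 // invr_eq0 expf_neq0 // mulf_neq0.
  - by exists q; [rewrite pq | rewrite lC'].
(* Otherwise every -1 + 4 b q m with m prime to q has trivial character. A nonzero c congruent to 1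
   modulo 4 b q is a quotient of two such numbers, so its character is trivial too. *)
have chi1 (c1 : int) : 1 + 4 * b * q%:Z * c1 != 0 -> chi (1 + 4 * b * q%:Z * c1) = 1.
  set c := 1 + _ => c0.
  have ht1 (m : int) : ndvd q m -> chi (-1 + 4 * b * q%:Z * m) = 1 /\
     -1 + 4 * b * q%:Z * m != 0.
    move=> qm; have t0 : -1 + 4 * b * q%:Z * m != 0.
      by rewrite -!mulrA m1D4_neq0.
    by split=> //; case: (chi2_cases sigma t0) => // h; case: Hn; exists m.
  (* Modulo q, c m - c1 is m - c1, so m = 1 or m = 2 will do. *)
  have [m qm qm'] : exists2 m : int, ndvd q m & ndvd q (c * m - c1).
    have em m : c * m - c1 = m - c1 + q%:Z * (4 * b * c1 * m) by rewrite /c; ring.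
    have [h1|h1] := boolP (dvdn q (absz (1 - c1))); last first.
      by exists 1; rewrite ?em ?ndvdD.
    exists 2 => //.
    rewrite em; apply: ndvdD; apply/negP => h2.
    have : (q%:Z %| (2 - c1) - (1 - c1))%Z by rewrite rpredB.
    have -> : 2 - c1 - (1 - c1) = 1 :> int by ring.
    by rewrite -[(_ %| _)%Z]/(dvdn q (absz (-1))) (negPf q1).
  have [h1 t0] := ht1 m qm; have [h2 _] := ht1 _ qm'.
  have e : c * (-1 + 4 * b * q%:Z * m) = -1 + 4 * b * q%:Z * (c * m - c1).
    by rewrite {2}/c [in LHS]/c; ring.
  by move: h2; rewrite -e chiM // h1 mulr1.
(* A second prime q' now carries the ramification: a multiple q' v congruent to 1 modulo 4 b q is
   sought, with v prime to q'. *)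
have [q' Nq' pq'] := prime_above (N + absz (4 * b * q%:Z)%R)%N.
have qn0' : q'%:Z != 0 by have := prime_gt0 pq'; case: (q').
have M0 : 4 * b * q%:Z != 0 by rewrite !mulf_neq0.
have qM' : ndvd q' (4 * b * q%:Z).
  exact: ndvd_small (leq_ltn_trans (leq_addl _ _) Nq').
have {}Nq' := leq_ltn_trans (leq_addr _ _) Nq'.
have [v [k [qv' evk]]] : exists v k : int, ndvd q' v /\
    q'%:Z * v = 1 + 4 * b * q%:Z * k.
  have : coprimez (4 * b * q%:Z) q'%:Z.
    by rewrite coprimezE coprime_sym prime_coprime.
  case/coprimezP => -[u v] /= euv.
  have [h|h] := boolP (dvdn q' (absz v)); last first.
    by exists v, (- u); split=> //; rewrite -[X in _ = X + _]euv; ring.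
  exists (v + 4 * b * q%:Z), (q'%:Z - u); split; last first.
    by rewrite -[X in _ = X + _]euv; ring.
  case/dvdzP: (h : (q'%:Z %| v)%Z) => j ->.
  by rewrite addrC [j * _]mulrC ndvdD.
(* Since z = (2 b q)^2 w, the value f(1 / z) has the class of w (1 + a z^2 + b z^3), which is again
   congruent to 1 modulo 4 b q. *)
pose w := q'%:Z * v; pose z := 4 * b ^+ 2 * q%:Z ^+ 2 * w.
pose C := w * (1 + a * z ^+ 2 + b * z ^+ 3).
have [lC C0] : logn q' (absz C) = 1%N /\ C != 0.
  have -> : C = q'%:Z * (v * (1 + q'%:Z * (4 * b ^+ 2 * q%:Z ^+ 2 * v *
     (a * z + b * z ^+ 2)))) by rewrite /C /z /w; ring.
  by apply: logn_primeM => //; rewrite ndvdM // ndvd1D.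
have w0 : w != 0 by apply: contraNneq C0 => h; rewrite /C h mul0r.
have z0 : z != 0.
  by rewrite /z; apply: mulf_neq0 => //; rewrite !mulf_neq0 ?expf_neq0.
have zq : (z%:~R : rat) != 0 by rewrite intr_eq0.
exists (z%:~R)^-1, C; split=> //.
- apply: (@small2_rat _ (b ^+ 2 * q%:Z ^+ 2 * w) 1) => //.
    by apply: mulf_neq0 => //; rewrite !mulf_neq0 ?expf_neq0.
  by rewrite invrK /z; field.
- pose c1 := k + w * (b * q%:Z * w * (a * z + b * z ^+ 2)).
  have eC : C = 1 + 4 * b * q%:Z * c1.
    transitivity (w + w * z * (a * z + b * z ^+ 2)); first by rewrite /C; ring.
    rewrite {1}/w evk /c1; rewrite {1}/z; ring.
  by move: C0; rewrite eC; apply: chi1.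
- exists (2 * b%:~R * q%:~R / z%:~R ^+ 2).
    by rewrite !mulf_neq0 ?invr_eq0 ?expf_neq0 ?intr_eq0.
  have ez : z%:~R = 4 * b%:~R ^+ 2 * q%:~R ^+ 2 * w%:~R :> rat by rewrite /z; ring.
  rewrite /C; transitivity (4 * b%:~R ^+ 2 * q%:~R ^+ 2 * w%:~R *
   (1 + a%:~R * z%:~R ^+ 2 + b%:~R * z%:~R ^+ 3) / z%:~R ^+ 4 : rat).
    by rewrite -ez; field.
  by field.
- by exists q'; [rewrite pq' | rewrite lC].
Qed.

End Cases.

(** * The curves with a = 0 *)

Lemma cube_root1_sum (z : algC) : z ^+ 3 = 1 -> z != 1 -> 1 + z + z ^+ 2 = 0.
Proof.
move=> z3 z1; have : (z - 1) * (1 + z + z ^+ 2) = 0.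
  by transitivity (z ^+ 3 - 1); [ring | rewrite z3 subrr].
by move/eqP; rewrite mulf_eq0 subr_eq0 (negPf z1) => /eqP.
Qed.

Lemma cube_roots1 (z w : algC) : z ^+ 3 = 1 -> z != 1 -> w ^+ 3 = 1 ->
  [\/ w = 1, w = z | w = z ^+ 2].
Proof.
move=> z3 z1 w3; have s := cube_root1_sum z3 z1.
have : (w - 1) * ((w - z) * (w - z ^+ 2)) = 0.
  transitivity (w ^+ 3 - z ^+ 3 - (1 + z + z ^+ 2) * (w ^+ 2 - z * w)).
    by ring.
  by rewrite w3 z3 s mul0r subr0 subrr.
move/eqP; rewrite !mulf_eq0 !subr_eq0.
by case/orP=> [/eqP|/orP[] /eqP]; [constructor 1 | constructor 2 | constructor 3].
Qed.

Section CubicPoints.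
Variables (sigma : {rmorphism algC -> algC}) (b : int).
Hypothesis b_neq0 : b != 0.
Local Notation W := (short_eqn 0%:~R b%:~R : weierstrass algC).

Let disc : 4 * 0 ^+ 3 + 27 * b ^+ 2 != 0 :> int.
Proof. by rewrite expr0n mulr0 add0r mulf_neq0 ?expf_neq0. Qed.

(** The coordinates exchange roles: y is rational and x is rho r. The cube root r is given
    explicitly, rather than through [chi], because sigma may move the cube roots of unity. *)
Definition cube_point (N : nat) (y : rat) (C : int) :=
  [/\ C != 0, exists2 r : algC, r ^+ 3 = C%:~R & sigma r = r,
      exists2 rho : rat, rho != 0 & y ^+ 2 - b%:~R = C%:~R * rho ^+ 3,
      exists n d : int, [/\ n != 0, odd (absz d) & y^-1 = 8 * n%:~R / d%:~R]
    & exists2 q : nat, prime q && (N < q)%N & logn q (absz C) = 1%N].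

(** The number 1 / (y^2 - b) is 64 n^2 / (d^2 - 64 b n^2), whose denominator is odd. So the cube of
    1 / (4 x) lies in [A2], and [A2_cube] applies; this is why 1 / y carries a factor 8. *)
Lemma small2_cube (y rho : rat) (r : algC) (C n d : int) :
  C != 0 -> r ^+ 3 = C%:~R -> rho != 0 ->
  y ^+ 2 - b%:~R = C%:~R * rho ^+ 3 -> n != 0 -> odd (absz d) ->
  y^-1 = 8 * n%:~R / d%:~R -> small2 (ratr rho * r).
Proof.
move=> C0 er rho0 ey n0 od eyi.
have d0 : d != 0 by apply: contraTneq od => ->.
have r0 : r != 0.
  apply: contraNneq C0 => r0; rewrite -(intr_eq0 algC) -er r0.
  by rewrite expr0n.
have rr0 : ratr rho != 0 :> algC by rewrite fmorph_eq0.
rewrite /small2 mulf_neq0 //=; apply: A2_cube.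
have ey' : y = d%:~R / (8 * n%:~R) by rewrite -[y]invrK eyi invf_div.
have oD : odd (absz (d ^+ 2 - 64 * b * n ^+ 2)%R).
  have -> : d ^+ 2 - 64 * b * n ^+ 2 = d ^+ 2 + 2 * (- 32 * b * n ^+ 2) by ring.
  have : odd (absz (d ^+ 2)%R) by rewrite abszX oddX od orbT.
  by move: (d ^+ 2) (_ * _ * _) => k l; clear; lia.
have D0 : d ^+ 2 - 64 * b * n ^+ 2 != 0 by apply: contraTneq oD => ->.
have nq : n%:~R != 0 :> rat by rewrite intr_eq0.
have eD : C%:~R * rho ^+ 3 = (d ^+ 2 - 64 * b * n ^+ 2)%:~R / (64 * n%:~R ^+ 2).
  by rewrite -ey ey'; field.
move: (d ^+ 2 - _) oD D0 eD => D oD D0 eD.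
have nC : n%:~R != 0 :> algC by rewrite intr_eq0.
have DC : D%:~R != 0 :> algC by rewrite intr_eq0.
have -> : ((ratr rho * r)^-1 / 4) ^+ 3 = n%:~R ^+ 2 * D%:~R^-1.
  have -> : ((ratr rho * r)^-1 / 4) ^+ 3 = (64 * (r ^+ 3 * ratr rho ^+ 3))^-1.
    by field; rewrite rr0 r0.
  have -> : r ^+ 3 * ratr rho ^+ 3 = ratr (C%:~R * rho ^+ 3).
    by rewrite er rmorphM rmorphXn /= ratr_int.
  rewrite eD; have -> : 64 * n%:~R ^+ 2 = (64 * n ^+ 2)%:~R :> rat by ring.
  rewrite fmorph_div /= !ratr_int.
  have -> : (64 * n ^+ 2)%:~R = 64 * n%:~R ^+ 2 :> algC by ring.
  by field; rewrite nC DC.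
by rewrite rpredM ?rpredX ?rpred_int // A2_odd_int_inv.
Qed.

(** If nu sends P = (x, y) to (z x, y) and fixes m P, then P, (z x, y) and (z^2 x, y) have the same
    multiple by m. They lie on a horizontal line and add up to 0, so 3 m P = 0, although P is
    nontorsion. *)
Lemma many_points_cubic : (forall N, exists y C, cube_point N y C) ->
  many_points W [pred x | sigma x == x].
Proof.
move=> H gens.
pose I (r : algC) (C : int) := exists y rho : rat,
  [/\ small2 (ratr rho * r), y ^+ 2 - b%:~R = C%:~R * rho ^+ 3,
      r ^+ 3 = C%:~R, C != 0 & sigma r = r].
have HI r C : I r C -> r ^+ 3 = C%:~R /\ C != 0 by case=> y [rho []].
have Hq N : exists r C q,
  [/\ I r C, prime q, (N < q)%N & ~~ dvdn 3 (logn q (absz C))].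
  have [y [C [C0 [r er sr] [rho rho0 ey] [n [d [n0 od eyi]]]]]] := H N.
  case=> q /andP[pq Nq] lq; exists r, C, q; rewrite lq; split=> //.
  by exists y, rho; split=> //; apply: small2_cube er rho0 ey n0 od eyi.
(* A primitive cube root of unity is added to [gens] so that nu fixes z and can be iterated on P. *)
have [om pom] := C_prim_root_exists (isT : 0 < 3)%N.
have [r [C [nu [[y [rho [sx ey er C0 sr]]] fnu nur]]]] :=
  kummer_move (e := 3) (om :: gens) isT HI Hq.
have r0 : r != 0.
  apply: contraNneq C0 => r0; rewrite -(intr_eq0 algC) -er r0.
  by rewrite expr0n.
pose z := nu r / r.
have z3 : z ^+ 3 = 1 by rewrite expr_div_n -rmorphXn /= er rmorph_int divff // intr_eq0.
have z1 : z != 1.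
  apply: contra_not_neq nur => h; by rewrite -[nu r](divfK r0) -/z h mul1r.
have nuz : nu z = z.
  have [i ->] := prim_rootP pom z3.
  by rewrite rmorphXn /= fnu // inE eqxx.
have enr : nu r = z * r by rewrite /z divfK.
have [x ex] : {x : algC | x = ratr rho * r} by eexists.
have [Y eYy] : {Y : algC | Y = ratr y} by eexists.
rewrite -ex in sx.
have x0 : x != 0 by case/andP: sx.
have nux : nu x = z * x by rewrite ex rmorphM fmorph_rat enr; ring.
have nuY : nu Y = Y by rewrite eYy fmorph_rat.
have eY : Y ^+ 2 = x ^+ 3 + b%:~R.
  have -> : x ^+ 3 = ratr (C%:~R * rho ^+ 3).
    by rewrite ex exprMn er rmorphM rmorphXn /= ratr_int mulrC.
  by rewrite -ey -(ratr_int algC b) -rmorphD /= subrK rmorphXn eYy.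
have onz k : on_curve W (Affine (z ^+ k * x) Y).
  rewrite on_shortE mul0r addr0 eY exprMn -exprM mulnC exprM z3 expr1n.
  by rewrite mul1r.
have c : on_curve W (Affine x Y) by have := onz 0%N; rewrite mul1r.
exists (Affine x Y).
  have sx' : sigma x = x by rewrite ex rmorphM fmorph_rat sr.
  have sY : sigma Y = Y by rewrite eYy fmorph_rat.
  by rewrite /rational_point c /= !inE sx' sY !eqxx.
move=> m m0; exists nu => [g gin|]; first by rewrite fnu // inE gin orbT.
rewrite map_natmul_short /= nux nuY => h1.
have := congr1 (map_pt nu) h1; rewrite !map_natmul_short /= rmorphM /= nuz nux nuY.
rewrite h1 mulrA -expr2 => h2.
have sum : add_pt W (Affine x Y) (Affine (z * x) Y) = opp_pt W (Affine (z ^+ 2 * x) Y).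
  have s := cube_root1_sum z3 z1.
  have sl : is_slope (0%:~R : algC) 0 x Y (z * x) Y.
    split; first by rewrite mul0r subrr.
    transitivity (x ^+ 2 * (1 + z + z ^+ 2)); first by rewrite s mulr0 mul0r.
    by ring.
  have no : ~~ ((x == z * x) && (Y == - Y)).
    rewrite negb_and; apply/orP; left; apply: contra z1 => /eqP e.
    by apply/eqP; apply: (mulIf x0); rewrite -e mul1r.
  rewrite (add_slope two_neq0C c (onz 1%N) no sl) opp_shortE; congr Affine.
    transitivity (z ^+ 2 * x - (1 + z + z ^+ 2) * x); first by ring.
    by rewrite s mul0r subr0.
  by ring.
apply: (small2_nontorsion disc c sx (n := (m + m + m)%N)); first by lia.
have n2 := two_neq0C; have dC := disc_neq0C disc.
have cz := onz 1%N; rewrite expr1 in cz.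
rewrite !natmulD // -{2}h1 -{2}h2 -natmul_addP // sum natmul_opp //.
by rewrite add_ptC ?on_curve_opp ?on_natmul // add_ptN.
Qed.

End CubicPoints.

(** * Rational y for which y^2 - b is a cube in the fixed field *)

Section CubicExistence.
Variables (sigma : {rmorphism algC -> algC}) (b : int).
Local Notation cube_point := (cube_point sigma b).

(* The class modulo cubes of y^2 - b for 1 / y = (u1 + u2) / (1 + b u1 u2). *)
Definition class0 (u1 u2 : int) : int :=
  (u1 + u2) * (1 - b * u1 ^+ 2) * (1 - b * u2 ^+ 2).

Lemma class0_logn (q : nat) (w1 w2 : int) : prime q -> ndvd q (8 * (w1 + w2)) ->
  let C := class0 (8 * q%:Z * w1) (8 * q%:Z * w2) in logn q (absz C) = 1%N /\ C != 0.
Proof.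
move=> pq hw; rewrite /=.
have -> : class0 (8 * q%:Z * w1) (8 * q%:Z * w2) = q%:Z * (8 * (w1 + w2) *
   (1 + q%:Z * (- 64 * b * q%:Z * w1 ^+ 2)) * (1 + q%:Z * (- 64 * b * q%:Z * w2 ^+ 2))).
  by rewrite /class0; ring.
by apply: logn_primeM => //; do 2! [apply: ndvdM => //; last exact: ndvd1D].
Qed.

(** This rests on (1 - b u1^2) (1 - b u2^2) = (1 + b u1 u2)^2 - b (u1 + u2)^2: dividing by (u1 +
    u2)^2 gives y^2 - b, which is the class divided by (u1 + u2)^3. *)
Lemma cube_point_class0 N (q : nat) (w1 w2 : int) : prime q -> (N < q)%N ->
  ndvd q (8 * (w1 + w2)) ->
  (exists2 r : algC, r ^+ 3 = (class0 (8 * q%:Z * w1) (8 * q%:Z * w2))%:~R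
     & sigma r = r) ->
  exists y C, cube_point N y C.
Proof.
move=> pq Nq hw hC; have [lC nC] := class0_logn pq hw.
have s0 : w1 + w2 != 0.
  by apply: contraNneq hw => ->; rewrite mulr0.
have q0 : q%:Z != 0 by have := prime_gt0 pq; case: (q).
have od : odd (absz (1 + b * (8 * q%:Z * w1) * (8 * q%:Z * w2))%R).
  have -> : 1 + b * (8 * q%:Z * w1) * (8 * q%:Z * w2) =
    1 + 2 * (32 * b * q%:Z ^+ 2 * w1 * w2) by ring.
  exact: odd_1D2.
have es : 8 * q%:Z * w1 + 8 * q%:Z * w2 = 8 * (q%:Z * (w1 + w2)) by ring.
have n0 : q%:Z * (w1 + w2) != 0 by rewrite mulf_neq0.
move: (8 * q%:Z * w1) (8 * q%:Z * w2) hC lC nC od es => u1 u2 hC lC nC od es.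
have zz0 : u1 + u2 != 0 by rewrite es mulf_neq0.
have zq : (u1%:~R + u2%:~R : rat) != 0 by rewrite -rmorphD intr_eq0.
exists ((1 + b * u1 * u2)%:~R / (u1 + u2)%:~R), (class0 u1 u2); split=> //.
- exists ((u1 + u2)%:~R^-1); first by rewrite invr_eq0 intr_eq0.
  by rewrite /class0; field.
- exists (q%:Z * (w1 + w2)), (1 + b * u1 * u2); split=> //.
  by rewrite invf_div es; congr (_ / _); ring.
- by exists q; rewrite ?pq.
Qed.

(** Having no fixed point on the three cube roots of t, sigma permutes them cyclically, so it
    preserves their ratios. Were it to invert a nontrivial z, it would fix z^2 r. *)
Lemma noncube_mu3 (t : int) :
  ~ (exists2 r : algC, r ^+ 3 = t%:~R & sigma r = r) ->
  forall z : algC, z ^+ 3 = 1 -> sigma z = z.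
Proof.
move=> ht; pose r := 3.-root (t%:~R : algC).
have er : r ^+ 3 = t%:~R by rewrite rootCK.
have r0 : r != 0.
  apply/eqP => r0; case: ht; exists 0; rewrite ?rmorph0 //.
  by rewrite -er r0.
pose z := sigma r / r.
have t0 : t%:~R != 0 :> algC by rewrite -er expf_neq0.
have z3 : z ^+ 3 = 1.
  by rewrite expr_div_n -rmorphXn /= er rmorph_int divff.
have esr : sigma r = z * r by rewrite /z divfK.
have z1 : z != 1.
  by apply: contra_not_neq ht => z1; exists r; rewrite // esr z1 mul1r.
have sz3 : sigma z ^+ 3 = 1 by rewrite -rmorphXn /= z3 rmorph1.
have [sz|sz|sz] := cube_roots1 z3 z1 sz3.
- by case/eqP: z1; apply: (fmorph_inj sigma); rewrite sz rmorph1.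
- move=> w /(cube_roots1 z3 z1)[] ->; rewrite ?rmorph1 // ?rmorphXn /= sz //.
case: ht; exists (z ^+ 2 * r).
  by rewrite exprMn -exprM mulnC exprM z3 expr1n mul1r.
rewrite rmorphM rmorphXn /= sz esr.
transitivity (z ^+ 3 * (z ^+ 2 * r)); first by ring.
by rewrite z3 mul1r.
Qed.

Section Character.
Hypothesis sigma_mu : forall z : algC, z ^+ 3 = 1 -> sigma z = z.
Local Notation chi := (chi sigma 3).
Let chiM := chiM (isT : (0 < 3)%N) sigma_mu.
Let chi_cube := chi_exp (isT : (0 < 3)%N) sigma_mu.
Let chi3 := chi_expe sigma (isT : (0 < 3)%N).

(** The character takes values in a group of order 3, so for two primes p and q it is trivial on one
    of p, q, p q and p q^2. *)
Lemma cubic_scale (z : algC) (N : nat) : z ^+ 3 = 1 -> z != 1 ->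
  exists (q : nat) (w : int),
  [/\ prime q, (N < q)%N, ndvd q w, w != 0 & chi (q%:Z * w) = 1].
Proof.
move=> z3 z1.
have [p Np pp] := prime_above N; have [q pq pq'] := prime_above p.
have p0 : p%:Z != 0 by have := prime_gt0 pp; case: (p).
have q0 : q%:Z != 0 by have := prime_gt0 pq'; case: (q).
have Nq := ltn_trans Np pq.
have hp (r : nat) : prime r -> ndvd r 1.
  by move=> pr; rewrite dvdn1 neq_ltn prime_gt1 ?orbT.
have hpq : ndvd p q%:Z.
  by rewrite /= dvdn_prime2 //; apply: contraTneq pq => ->; rewrite ltnn.
have h1 : chi p%:Z = 1 -> exists (q : nat) (w : int),
  [/\ prime q, (N < q)%N, ndvd q w, w != 0 & chi (q%:Z * w) = 1].
  by move=> h; exists p, 1; split; rewrite ?hp ?mulr1.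
have h2 : chi q%:Z = 1 -> exists (q : nat) (w : int),
  [/\ prime q, (N < q)%N, ndvd q w, w != 0 & chi (q%:Z * w) = 1].
  by move=> h; exists q, 1; split; rewrite ?hp ?mulr1.
have h3 : chi p%:Z * chi q%:Z = 1 -> exists (q : nat) (w : int),
  [/\ prime q, (N < q)%N, ndvd q w, w != 0 & chi (q%:Z * w) = 1].
  by move=> h; exists p, q%:Z; split; rewrite ?chiM.
have h4 : chi p%:Z * chi q%:Z ^+ 2 = 1 -> exists (q : nat) (w : int),
  [/\ prime q, (N < q)%N, ndvd q w, w != 0 & chi (q%:Z * w) = 1].
  move=> h; exists p, (q%:Z * q%:Z); split; rewrite ?mulf_neq0 ?ndvdM //.
  by rewrite !chiM ?mulf_neq0 // -expr2.
case: (cube_roots1 z3 z1 (chi3 p0)) => // ep;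
  case: (cube_roots1 z3 z1 (chi3 q0)) => // eq.
- by apply: h4; rewrite ep eq -exprS.
- by apply: h3; rewrite ep eq -exprS.
- by apply: h3; rewrite ep eq -exprSr.
- apply: h4; rewrite ep eq -exprM -exprD.
  by rewrite -[(2 + 2 * 2)%N]/(3 * 2)%N exprM z3 expr1n.
Qed.

(* If no value of y works, then chi (y1^2 - b) is z or z^2: the first three sums
   exclude z, and the last three exclude z^2. *)
Lemma cubic_five (t y1 y2 y3 y4 y5 A1 A2 A3 A4 : int) (N : nat) :
  chi t != 1 -> t != 0 -> y1 != 0 -> y2 != 0 -> y3 != 0 -> y4 != 0 -> y5 != 0 ->
  A1 != 0 -> A2 != 0 -> A3 != 0 -> A4 != 0 ->
  y1 + y2 = t * A1 ^+ 3 -> y1 + y3 = t * A2 ^+ 3 -> y2 + y3 = t ^+ 2 * 4 ^+ 3 ->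
  y1 + y4 = t ^+ 2 * A3 ^+ 3 -> y1 + y5 = t ^+ 2 * A4 ^+ 3 ->
  y4 + y5 = t * (4 * t) ^+ 3 ->
  exists y C, cube_point N y C.
Proof.
set z := chi t => z1 t0 n1 n2 n3 n4 n5 a1 a2 a3 a4 e12 e13 e23 e14 e15 e45.
have z3 : z ^+ 3 = 1 by exact: chi3.
apply: contrapT => Hn.
pose S := 8 * (y1 * y2 * y3 * y4 * y5) *
  ((y1 + y2) * (y1 + y3) * (y2 + y3) * (y1 + y4) * (y1 + y5) * (y4 + y5)).
have S0 : S != 0.
  rewrite /S e12 e13 e23 e14 e15 e45.
  by repeat first [ assumption | apply: expf_neq0 | apply: mulf_neq0 | by [] ].
have [q [w [pq Nq qw w0 hqw]]] := cubic_scale (N + absz S) z3 z1.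
have qS := ndvd_small S0 (leq_ltn_trans (leq_addl _ _) Nq).
have {}Nq := leq_ltn_trans (leq_addr _ _) Nq.
have q0 : q%:Z != 0 by have := prime_gt0 pq; case: (q).
move: qS; rewrite /S => {S S0} /ndvdMl[/ndvdMl[q8 /ndvdMl[/ndvdMl[/ndvdMl[/ndvdMl[
  q1 q2] q3] q4] q5]]].
move=> /ndvdMl[/ndvdMl[/ndvdMl[/ndvdMl[/ndvdMl[q12 q13] q23] q14] q15] q45].
pose P := y1 * y2 * y3 * y4 * y5.
have P0 : P != 0 by rewrite /P !mulf_neq0.
have qP : ndvd q P by rewrite /P !ndvdM.
(* The integer G has trivial character and is divisible enough for each G / yi to be a parameter of
   the form 8 q times an integer. *)
pose G := (2 * P) ^+ 3 * (q%:Z * w).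
have G0 : G != 0 by rewrite mulf_neq0 ?expf_neq0 ?mulf_neq0.
have chiG : chi G = 1.
  by rewrite /G chiM ?expf_neq0 ?mulf_neq0 // chi_cube ?mulf_neq0 // mul1r.
have single (x e : int) : x * e = P -> x != 0 -> ndvd q e ->
    let u := 8 * q%:Z * (w * P ^+ 2 * e) in
    [/\ x * u = G, class0 u 0 != 0 & chi (class0 u 0) = z \/ chi (class0 u 0) = z ^+ 2].
  move=> ex x0 qe u.
  have hw : ndvd q (8 * (w * P ^+ 2 * e + 0)).
    by rewrite addr0; repeat apply: ndvdM => //; apply: ndvdX.
  have [_] := class0_logn pq hw; rewrite mulr0 -/u => nC.
  split=> //; first by rewrite /u /G -ex; ring.
  case: (cube_roots1 z3 z1 (chi3 nC)) => h; [|by left|by right].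
  case: Hn; apply: (cube_point_class0 pq Nq hw); rewrite mulr0 -/u.
  exact: (chi_eq1 (e := 3) isT nC h).
(* For u = G / x and u' = G / x', one has (u + u') G = (x + x') u u'. Thus the class of the pair is
   x + x' times the two single classes, up to factors of trivial character. *)
have pair (x e x' e' : int) : x * e = P -> x' * e' = P -> x != 0 -> x' != 0 ->
    ndvd q (e + e') -> x + x' != 0 -> ndvd q e -> ndvd q e' ->
    chi (x + x') * chi (class0 (8 * q%:Z * (w * P ^+ 2 * e)) 0) *
    chi (class0 (8 * q%:Z * (w * P ^+ 2 * e')) 0) != 1.
  move=> ex ex' x0 x0' qee s0 qe qe'.
  set u := 8 * q%:Z * (w * P ^+ 2 * e); set u' := 8 * q%:Z * (w * P ^+ 2 * e').
  have [eu nu _] := single x e ex x0 qe; rewrite -/u in eu nu.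
  have [eu' nu' _] := single x' e' ex' x0' qe'; rewrite -/u' in eu' nu'.
  have hw : ndvd q (8 * (w * P ^+ 2 * e + w * P ^+ 2 * e')).
    by rewrite -mulrDr; repeat apply: ndvdM => //; apply: ndvdX.
  have [_] := class0_logn pq hw; rewrite -/u -/u' => nC.
  have eC : class0 u u' * G = (x + x') * (class0 u 0 * class0 u' 0).
    apply: (mulfI G0).
    transitivity (class0 u u' * ((x * u) * (x' * u'))); first by rewrite eu eu'; ring.
    transitivity ((x' * (x * u) + x * (x' * u')) * (class0 u 0 * class0 u' 0)).
      by rewrite /class0; ring.
    by rewrite eu eu'; ring.
  have := congr1 chi eC; rewrite (chiM nC G0) chiG mulr1.
  rewrite (chiM s0 (mulf_neq0 nu nu')) (chiM nu nu') mulrA => <-.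
  apply/eqP => h; case: Hn; apply: (cube_point_class0 pq Nq hw).
  exact: (chi_eq1 (e := 3) isT nC h).
have ct : chi t = z by [].
have n12 : y1 + y2 != 0 by rewrite e12 mulf_neq0 ?expf_neq0.
have n13 : y1 + y3 != 0 by rewrite e13 mulf_neq0 ?expf_neq0.
have n23 : y2 + y3 != 0 by rewrite e23 mulf_neq0 ?expf_neq0.
have n14 : y1 + y4 != 0 by rewrite e14 mulf_neq0 ?expf_neq0.
have n15 : y1 + y5 != 0 by rewrite e15 mulf_neq0 ?expf_neq0.
have n45 : y4 + y5 != 0 by rewrite e45 mulf_neq0 ?expf_neq0 ?mulf_neq0.
have ct2 : chi (t ^+ 2) = z ^+ 2 by rewrite !expr2 chiM.
have c12 : chi (y1 + y2) = z.
  by rewrite e12 chiM ?expf_neq0 // chi_cube // mulr1.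
have c13 : chi (y1 + y3) = z.
  by rewrite e13 chiM ?expf_neq0 // chi_cube // mulr1.
have c23 : chi (y2 + y3) = z ^+ 2.
  by rewrite e23 chiM ?expf_neq0 // chi_cube // mulr1.
have c14 : chi (y1 + y4) = z ^+ 2.
  by rewrite e14 chiM ?expf_neq0 // chi_cube // mulr1.
have c15 : chi (y1 + y5) = z ^+ 2.
  by rewrite e15 chiM ?expf_neq0 // chi_cube // mulr1.
have c45 : chi (y4 + y5) = z.
  by rewrite e45 chiM ?expf_neq0 ?mulf_neq0 // chi_cube ?mulf_neq0 // mulr1.
pose f1 := y2 * y3 * y4 * y5; pose f2 := y1 * y3 * y4 * y5.
pose f3 := y1 * y2 * y4 * y5; pose f4 := y1 * y2 * y3 * y5.
pose f5 := y1 * y2 * y3 * y4.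
have g1 : y1 * f1 = P by rewrite /f1 /P; ring.
have g2 : y2 * f2 = P by rewrite /f2 /P; ring.
have g3 : y3 * f3 = P by rewrite /f3 /P; ring.
have g4 : y4 * f4 = P by rewrite /f4 /P; ring.
have g5 : y5 * f5 = P by rewrite /f5 /P; ring.
have k1 : ndvd q f1 by rewrite !ndvdM.
have k2 : ndvd q f2 by rewrite !ndvdM.
have k3 : ndvd q f3 by rewrite !ndvdM.
have k4 : ndvd q f4 by rewrite !ndvdM.
have k5 : ndvd q f5 by rewrite !ndvdM.
have k12 : ndvd q (f1 + f2).
  have -> : f1 + f2 = y3 * y4 * y5 * (y1 + y2) by rewrite /f1 /f2; ring.
  by rewrite !ndvdM.
have k13 : ndvd q (f1 + f3).
  have -> : f1 + f3 = y2 * y4 * y5 * (y1 + y3) by rewrite /f1 /f3; ring.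
  by rewrite !ndvdM.
have k23 : ndvd q (f2 + f3).
  have -> : f2 + f3 = y1 * y4 * y5 * (y2 + y3) by rewrite /f2 /f3; ring.
  by rewrite !ndvdM.
have k14 : ndvd q (f1 + f4).
  have -> : f1 + f4 = y2 * y3 * y5 * (y1 + y4) by rewrite /f1 /f4; ring.
  by rewrite !ndvdM.
have k15 : ndvd q (f1 + f5).
  have -> : f1 + f5 = y2 * y3 * y4 * (y1 + y5) by rewrite /f1 /f5; ring.
  by rewrite !ndvdM.
have k45 : ndvd q (f4 + f5).
  have -> : f4 + f5 = y1 * y2 * y3 * (y4 + y5) by rewrite /f4 /f5; ring.
  by rewrite !ndvdM.
have := pair _ _ _ _ g1 g2 n1 n2 k12 n12 k1 k2.
have := pair _ _ _ _ g1 g3 n1 n3 k13 n13 k1 k3.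
have := pair _ _ _ _ g2 g3 n2 n3 k23 n23 k2 k3.
have := pair _ _ _ _ g1 g4 n1 n4 k14 n14 k1 k4.
have := pair _ _ _ _ g1 g5 n1 n5 k15 n15 k1 k5.
have := pair _ _ _ _ g4 g5 n4 n5 k45 n45 k4 k5.
have [_ _] := single _ _ g1 n1 k1.
have [_ _] := single _ _ g2 n2 k2.
have [_ _] := single _ _ g3 n3 k3.
have [_ _] := single _ _ g4 n4 k4.
have [_ _] := single _ _ g5 n5 k5.
rewrite /= c12 c13 c23 c14 c15 c45.
move: (chi (class0 (8 * q%:Z * (w * P ^+ 2 * f1)) 0)) => v1.
move: (chi (class0 (8 * q%:Z * (w * P ^+ 2 * f2)) 0)) => v2.
move: (chi (class0 (8 * q%:Z * (w * P ^+ 2 * f3)) 0)) => v3.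
move: (chi (class0 (8 * q%:Z * (w * P ^+ 2 * f4)) 0)) => v4.
move: (chi (class0 (8 * q%:Z * (w * P ^+ 2 * f5)) 0)) => v5.
have E1 : z * z * z = 1 by transitivity (z ^+ 3); [ring|].
have E2 : z ^+ 2 * z ^+ 2 * z ^+ 2 = 1 
  by transitivity (z ^+ 3 * z ^+ 3); [ring | rewrite z3 mulr1].
(* If v1 = z, the pairs with y1 force v2 = v3 = z^2, and the third product is z^6 = 1. If v1 = z^2,
   they force v4 = v5 = z, and the last product is z^3 = 1. *)
move=> [->|->] [->|->] [->|->] [->|->] [->|->]; by rewrite ?E1 ?E2 eqxx.
Qed.

End Character.

(** A first parameter either succeeds or provides a noncube t0. In the latter case sigma fixes the
    cube roots of unity, so the cubic character becomes available. *)
Lemma cubic_points N : exists y C, cube_point N y C.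
Proof.
apply: contrapT => Hn.
have [q Nq pq] := prime_above (N + 8).
have Nq' : (N < q)%N by lia.
have hq : ndvd q (8 * (1 + 0)) by apply: ndvd_small => //; lia.
have [_ t00] := class0_logn pq hq.
have ht0 : ~ (exists2 r : algC,
    r ^+ 3 = (class0 (8 * q%:Z * 1) (8 * q%:Z * 0))%:~R & sigma r = r).
  by move=> h; apply: Hn; apply: cube_point_class0 hq h.
have mu3 := noncube_mu3 ht0.
move: (class0 _ _) t00 ht0 {hq} => t0 t00 ht0.
have chit0 : chi sigma 3 t0 != 1.
  by apply/eqP => h; case: ht0; apply: (chi_eq1 (e := 3) isT t00 h).
apply: Hn; pose t := 2 * (4 * t0).
have oddn (k : int) : 1 + 2 * k != 0 by apply: contraTneq (odd_1D2 k) => ->.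
have tn0 : t != 0 by rewrite !mulf_neq0.
have chit : chi sigma 3 t != 1.
  have -> : t = 2 ^+ 3 * t0 by rewrite /t; ring.
  by rewrite chiM // chi_exp // mul1r.
(* A rational solution of A1^3 + A2^3 + (4 t)^3 = t (A3^3 + A4^3 + 4^3), which
   is the compatibility condition for the system in cubic_five; the factor 8
   in t makes the cofactors below odd, hence nonzero. *)
pose y1 := 4 * t ^+ 2 * (19 * t ^+ 2 + 18 * t + 19).
(* Here y1 is half of (y1 + y2) + (y1 + y3) - (y2 + y3), and the other yi come from their prescribed
   sums with y1. *)
apply: (@cubic_five mu3 t y1 (t * (3 + 5 * t) ^+ 3 - y1)
  (t * (3 * (t - 1)) ^+ 3 - y1) (t ^+ 2 * (5 + 3 * t) ^+ 3 - y1)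
  (t ^+ 2 * (3 * (1 - t)) ^+ 3 - y1)
  (3 + 5 * t) (3 * (t - 1)) (5 + 3 * t) (3 * (1 - t))) => //;
  rewrite ?[y1 + (_ - y1)]addrC ?subrK //.
- have -> : y1 = 4 * t ^+ 2 * (1 + 2 * (9 + 9 * t + 19 * t * (4 * t0))).
    by rewrite /y1 /t; ring.
  by rewrite !mulf_neq0 // expf_neq0.
- have -> : t * (3 + 5 * t) ^+ 3 - y1 =
     t * (1 + 2 * (13 + (4 * t0) * (49 * t ^+ 2 + 153 * t + 59))).
    by rewrite /y1 /t; ring.
  by rewrite mulf_neq0.
- have -> : t * (3 * (t - 1)) ^+ 3 - y1 =
     - t * (1 + 2 * (13 + (4 * t0) * (49 * t ^+ 2 + 153 * t - 5))).
    by rewrite /y1 /t; ring.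
  by rewrite mulf_neq0 // oppr_eq0.
- have -> : t ^+ 2 * (5 + 3 * t) ^+ 3 - y1 =
     t ^+ 2 * (1 + 2 * (24 + (4 * t0) * (27 * t ^+ 2 + 59 * t + 153))).
    by rewrite /y1 /t; ring.
  by rewrite mulf_neq0 // expf_neq0.
- have -> : t ^+ 2 * (3 * (1 - t)) ^+ 3 - y1 =
     - t ^+ 2 * (1 + 2 * (24 + (4 * t0) * (27 * t ^+ 2 - 5 * t + 153))).
    by rewrite /y1 /t; ring.
  by rewrite mulf_neq0 // oppr_eq0 expf_neq0.
- have -> : 3 + 5 * t = 1 + 2 * (1 + 5 * (4 * t0)) by rewrite /t; ring.
  exact: oddn.
- have -> : 3 * (t - 1) = - 3 * (1 + 2 * (- (4 * t0))) by rewrite /t; ring.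
  by rewrite mulf_neq0.
- have -> : 5 + 3 * t = 1 + 2 * (2 + 3 * (4 * t0)) by rewrite /t; ring.
  exact: oddn.
- have -> : 3 * (1 - t) = 3 * (1 + 2 * (- (4 * t0))) by rewrite /t; ring.
  by rewrite mulf_neq0.
- by rewrite /y1; ring.
- by rewrite /y1; ring.
Qed.

End CubicExistence.

Theorem theorem1p3 (E : elliptic_curve rat)
    (sigma : {rmorphism algC -> algC}) (hsigma : bijective sigma) :
  infinite_rank (map_weierstrass (ratr : rat -> algC) (ec_eqn E))
    [pred x : algC | sigma x == x].
Proof.
apply: infinite_rank_many_points; apply: short_model => a b disc.
have [b0|b0] := eqVneq b 0.
  by apply: many_points_quad => // N; apply: quad_points_1728.
have [a0|a0] := eqVneq a 0.
  by rewrite a0; apply: many_points_cubic => // N; apply: cubic_points.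
by apply: many_points_quad => // N; apply: quad_points_generic.
Qed.
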